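(* Let $G$ be a diffeological group and $X$ a diffeological space. (1) Let $\pi:P\to X$ be an object of $\mathcal DG/X$. Then $\pi:P\to X$ is a diffeological principal $G$-bundle if and only if $S^{\mathcal D}_{\mathrm{aff}}(\pi):S^{\mathcal D}_{\mathrm{aff}}(P)\to S^{\mathcal D}_{\mathrm{aff}}(X)$ is a (simplicial) principal $S^{\mathcal D}_{\mathrm{aff}}(G)$-bundle. (2) The functor $S^{\mathcal D}_{\mathrm{aff}}:\mathcal D\to\mathcal S$ induces a faithful functor from the category $\mathsf P\mathcal DG_{\mathrm{diff}}$ of diffeological principal $G$-bundles to the category $\mathsf P\mathcal S\,S^{\mathcal D}_{\mathrm{aff}}(G)$ of principal $S^{\mathcal D}_{\mathrm{aff}}(G)$-bundles.
   Context: A diffeological space is a set $X$ with a set $D_X$ of maps $U\to X$ (plots), $U$ open in some $\mathbb R^n$, that contains all constant maps, is local and is closed under precomposition with smooth maps between open subsets of Euclidean spaces. A map $f:X\to Y$ is smooth if $f\circ p$ is a plot for every plot $p$. $\mathcal D$ is the category of diffeological spaces and smooth maps; subsets carry the sub-diffeology; open subsets of $X$ refer to the final topology for the plots. $\mathcal S$ is the category of simplicial sets. A diffeological group is a group object in $\mathcal D$. Let $\mathbb A^p=\{(x_0,\dots,x_p)\in\mathbb R^{p+1}:\sum x_i=1\}$ with the sub-diffeology of $\mathbb R^{p+1}$; $\mathbb A^\bullet$ is a cosimplicial diffeological space via affine maps, and $S^{\mathcal D}_{\mathrm{aff}}(X)=\mathcal D(\mathbb A^\bullet,X)$. The functor $S^{\mathcal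 D}_{\mathrm{aff}}$ preserves limits, so $S^{\mathcal D}_{\mathrm{aff}}(G)$ is a simplicial group, and it acts on the right on $S^{\mathcal D}_{\mathrm{aff}}(P)$ when $G$ acts smoothly on the right on $P$. For a category $\mathcal C$ with finite products, a group $G$ in $\mathcal C$ and $B\in\mathcal C$, $\mathcal CG$ denotes the category of objects of $\mathcal C$ with a right $G$-action and $\mathcal CG/B$ the category of objects of $\mathcal CG$ over $B$, where $B$ has the trivial $G$-action. An object $\pi:E\to X$ of $\mathcal DG/X$ is a locally trivial principal $G$-bundle if there is an open cover $\{U_i\}$ of $X$ such that each restriction $\pi^{-1}(U_i)\to U_i$ is $G$-equivariantly diffeomorphic over $U_i$ to the projection $U_i\times G\to U_i$. An object $\pi:E\to X$ of $\mathcal DG/X$ is a diffeological principal $G$-bundle if for every plot $p:U\to X$ the pullback $p^*E\to U$ is a locally trivial principal $G$-bundle. Morphisms in $\mathsf P\mathcal DG_{\mathrm{diff}}$ from $\pi:E\to X$ to $\pi':E'\to X'$ are commutative squares in $\mathcal DG$, i.e. pairs of a smooth $G$-equivariant map $\hat f:E\to E'$ and a smooth map $f:X\to X'$ with $\pi'\hat f=f\pi$. For a simplicial group $H$, an object $\pi:E\to K$ of $\mathcal SH/K$ is a principal $H$-bundle if for every simplicial map $k:\Delta[p]\to K$ $(p\geq 0)$ the pullback $k^*E\to\Delta[p]$ is $H$-equivariantly isomorphic over $\Delta[p]$ to the projection $\Delta[p]\times H\to\Delta[p]$. Morphisms in $\mathsf P\mathcal SH$ are commutative squares in $\mathcal SH$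 between principal $H$-bundles (with bases having trivial action). *)

(* Defs.v *)
From HB Require Import structures.
From mathcomp Require Import all_boot all_order all_algebra.
From mathcomp Require Import all_classical all_reals all_analysis.
Import Order.TTheory GRing.Theory Num.Theory.
Import numFieldNormedType.Exports.
Set Implicit Arguments.
Unset Strict Implicit.
Unset Printing Implicit Defensive.
Local Open Scope classical_set_scope.
Local Open Scope ring_scope.

Section Ck.
Variable R : realType.

(* [Ck k U f]: f is of class C^k on U, for k : nat.  The set U is meant to be
   open; only the values of f near points of U matter. *)
Fixpoint Ck (V W : normedModType R) (k : nat) (U : set V) (f : V -> W) : Prop :=
  if k is k'.+1 then
    (forall x, U x -> differentiable f x) /\ (forall v, Ck k' U ('D_v f))
  else forall x, U x -> {for x, continuous f}.

Lemma near_eq_differentiable (V W : normedModType R) (f g : V -> W) (a : V) :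
  (\forall x \near a, f x = g x) -> differentiable f a -> differentiable g a.
Proof.
move=> fg df.
have dgE : g \o shift a = cst (g a) + 'd f a +o_ 0 id.
  apply/eqaddoP => _/posnumP[e].
  have /eqaddoP/(_ _ (gt0 e)) := diff_locally df.
  have fg0 : \forall h \near (0 : V), f (h + a) = g (h + a).
    move: fg; rewrite (near_shift 0 a) /=.
    by apply: filterS => x; rewrite /= subr0.
  apply: filterS2 fg0 => x fgx.
  by rewrite !fctE /= fgx (nbhs_singleton fg).
have dgd := diff_unique (diff_continuous df) dgE.
by apply/diff_locallyP; rewrite dgd; split => //; apply: diff_continuous.
Qed.

Lemma open_near_eq (V : normedModType R) (W : Type) (U : set V) (f g : V -> W) x :
  open U -> (forall y, U y -> f y = g y) -> U x -> \forall y \near x, f y = g y.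
Proof.
move=> oU fg Ux; have := open_nbhs_nbhs (conj oU Ux).
by apply: filterS => y /fg.
Qed.

Lemma Ck_eq (V W : normedModType R) k (U : set V) (f g : V -> W) : open U ->
  (forall x, U x -> f x = g x) -> Ck k U f -> Ck k U g.
Proof.
move=> oU; elim: k f g => [|k IH] f g fg /=.
  move=> cf x Ux; have nfg := open_near_eq oU fg Ux.
  suff : g @ x --> g x by [].
  by rewrite -(fg _ Ux); apply: cvg_trans (cf _ Ux); apply: near_eq_cvg.
case=> df Df; split=> [x Ux|v].
  exact: near_eq_differentiable (open_near_eq oU fg Ux) (df _ Ux).
apply: IH (Df v) => x Ux; apply: near_eq_derive.
exact: (open_near_eq oU fg Ux).
Qed.

Lemma Ck_sub (V W : normedModType R) k (U U' : set V) (f : V -> W) :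
  U' `<=` U -> Ck k U f -> Ck k U' f.
Proof.
move=> sU; elim: k f => [|k IH] f /=; first by move=> cf x /sU; apply: cf.
by case=> df Df; split=> [x /sU|v]; [apply: df|apply: IH].
Qed.

Lemma Ck_local (V W : normedModType R) k (U : set V) (f : V -> W) :
  (forall x, U x -> exists2 U' : set V, U' x & Ck k U' f) -> Ck k U f.
Proof.
elim: k f => [|k IH] f loc /=.
  by move=> x /loc[U' U'x]; apply.
split=> [x /loc[U' U'x [+ _]]|v]; first exact.
apply: IH => x Ux; have [U' U'x [_ D]] := loc x Ux.
by exists U'; last exact: D.
Qed.

Lemma CkS (V W : normedModType R) k (U : set V) (f : V -> W) :
  Ck k.+1 U f -> Ck k U f.
Proof.
elim: k f => [|k IH] f [df Df].
  by move=> x /df; apply: differentiable_continuous.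
by split=> // v; apply: IH.
Qed.

Lemma Ck_cst (V W : normedModType R) k (U : set V) (c : W) :
  Ck k U (fun _ : V => c).
Proof.
elim: k c => [|k IH] c /=; first by move=> x _; apply: cst_continuous.
split=> [x _|v]; first exact: differentiable_cst.
rewrite (_ : 'D_v _ = fun=> 0); first exact: IH.
by apply/funext => x; apply: derive_cst.
Qed.

Lemma Ck_postlin (V W W' : normedModType R) (L : {linear W -> W'}) k
    (U : set V) (f : V -> W) : open U -> continuous L ->
  Ck k U f -> Ck k U (L \o f).
Proof.
move=> oU cL; elim: k f => [|k IH] f /=.
  by move=> cf x Ux; apply: continuous_comp; [apply: cf|apply: cL].
have dL y : differentiable L y by apply: linear_differentiable.
case=> df Df; split=> [x Ux|v].
  by apply: differentiable_comp => //; apply: df.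
apply: Ck_eq (IH _ (Df v)) => // x Ux /=.
have dfx := df _ Ux.
rewrite (deriveE v dfx) (deriveE v (differentiable_comp dfx (dL _))).
by rewrite (diff_comp dfx (dL _)) /= diff_lin.
Qed.

Lemma Ck_lin (V W : normedModType R) (L : {linear V -> W}) k (U : set V) :
  continuous L -> Ck k U L.
Proof.
move=> cL; case: k => [|k] /=; first by move=> x _; apply: cL.
split=> [x _|v]; first exact: linear_differentiable.
rewrite (_ : 'D_v _ = fun=> L v); first exact: Ck_cst.
apply/funext => x; rewrite deriveE ?diff_lin //.
exact: linear_differentiable.
Qed.

Lemma Ck_id (V : normedModType R) k (U : set V) : Ck k U (@id V).
Proof. by apply: (@Ck_lin V V (@idfun V)) => x. Qed.

Lemma CkD (V W : normedModType R) k (U : set V) (f g : V -> W) : open U ->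
  Ck k U f -> Ck k U g -> Ck k U (f + g).
Proof.
move=> oU; elim: k f g => [|k IH] f g /=.
  by move=> cf cg x Ux; apply: continuousD; [apply: cf|apply: cg].
move=> [df Df] [dg Dg]; split=> [x Ux|v].
  by apply: differentiableD; [apply: df|apply: dg].
apply: Ck_eq (IH _ _ (Df v) (Dg v)) => // x Ux.
by rewrite deriveD //; apply: diff_derivable; [apply: df|apply: dg].
Qed.

Lemma Ck_sum (V W : normedModType R) k (U : set V) n (f : 'I_n -> V -> W) :
  open U -> (forall i, Ck k U (f i)) -> Ck k U (\sum_i f i).
Proof.
move=> oU Cf; elim/big_ind : _ => //; first exact: Ck_cst.
by move=> ? ?; apply: CkD.
Qed.

Lemma CkM (V : normedModType R) k (U : set V) (f g : V -> R) : open U ->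
  Ck k U f -> Ck k U g -> Ck k U (f * g).
Proof.
move=> oU; elim: k f g => [|k IH] f g.
  by move=> cf cg x Ux; apply: continuousM; [apply: cf|apply: cg].
move=> Cf Cg; have [Cf' Cg'] := (CkS Cf, CkS Cg).
case: Cf Cg => [df Df] [dg Dg]; split=> [x Ux|v].
  by apply: differentiableM; [apply: df|apply: dg].
apply: Ck_eq (CkD oU (IH _ _ Cf' (Dg v)) (IH _ _ Cg' (Df v))) => // x Ux.
by rewrite deriveM //; apply: diff_derivable; [apply: df|apply: dg].
Qed.

Definition ck_coord n (j : 'I_n) : 'rV[R]_n -> R := fun x => x 0 j.

Lemma ck_coord_is_linear n (j : 'I_n) : linear (ck_coord j).
Proof. by move=> a x y; rewrite /ck_coord !mxE. Qed.

HB.instance Definition _ n (j : 'I_n) :=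
  GRing.isLinear.Build R 'rV[R]_n R _ (ck_coord j) (@ck_coord_is_linear n j).

Definition ck_scalel (W : normedModType R) (w : W) : R -> W := fun a => a *: w.

Lemma ck_scalel_is_linear (W : normedModType R) (w : W) : linear (ck_scalel w).
Proof. by move=> a x y; rewrite /ck_scalel scalerDl scalerA. Qed.

HB.instance Definition _ (W : normedModType R) (w : W) :=
  GRing.isLinear.Build R R W _ (ck_scalel w) (ck_scalel_is_linear w).

Lemma Ck_coordP (V : normedModType R) k n (U : set V) (f : V -> 'rV[R]_n) :
  open U -> Ck k U f <-> (forall j, Ck k U (fun x => f x 0 j)).
Proof.
move=> oU; split=> [Cf j|Cf].
  apply: (Ck_postlin (L := ck_coord j)) => // x; exact: coord_continuous.
apply: (@Ck_eq _ _ _ _ (\sum_j (ck_scalel (delta_mx 0 j) \o fun x => f x 0 j))) => //.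
  by move=> x _; rewrite fct_sumE [f x in RHS]row_sum_delta.
apply: Ck_sum => // j; apply: Ck_postlin => //.
exact: scalel_continuous.
Qed.

Lemma Ck_comp_scalar m n k (U : set 'rV[R]_m) (V : set 'rV[R]_n)
    (f : 'rV[R]_m -> 'rV[R]_n) (h : 'rV[R]_n -> R) :
  open U -> (forall x, U x -> V (f x)) ->
  Ck k U f -> Ck k V h -> Ck k U (h \o f).
Proof.
move=> oU fUV Cf Ch.
elim: k f fUV Cf h Ch => [|k IH] f fUV Cf h Ch.
  by move=> x Ux; apply: continuous_comp; [apply: Cf|apply: Ch; apply: fUV].
have Cf' := CkS Cf; case: Cf Ch => [df Df] [dh Dh]; split=> [x Ux|v].
  by apply: differentiable_comp; [apply: df|apply: dh; apply: fUV].
apply: (@Ck_eq _ _ _ _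
  (\sum_j ((fun x => 'D_v f x 0 j) * ('D_(delta_mx 0 j) h \o f)))) => //.
  move=> x Ux; have [dfx dhx] := (df _ Ux, dh _ (fUV _ Ux)).
  rewrite fct_sumE (deriveE v (differentiable_comp dfx dhx)) diff_comp //=.
  rewrite -(deriveE v dfx) [X in _ = 'd h (f x) X]row_sum_delta linear_sum.
  apply: eq_bigr => i _; rewrite linearZ /=.
  by rewrite [_ x]/(_ * _) /= (deriveE _ dhx).
apply: Ck_sum => // i; apply: CkM => //.
  by have /(Ck_coordP _ _ oU) := Df v; apply.
exact: (IH _ fUV Cf' _ (Dh _)).
Qed.

Lemma Ck_comp m n p k (U : set 'rV[R]_m) (V : set 'rV[R]_n)
    (f : 'rV[R]_m -> 'rV[R]_n) (g : 'rV[R]_n -> 'rV[R]_p) :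
  open U -> open V -> (forall x, U x -> V (f x)) ->
  Ck k U f -> Ck k V g -> Ck k U (g \o f).
Proof.
move=> oU oV fUV Cf /(Ck_coordP _ _ oV) Cg; apply/(Ck_coordP _ _ oU) => j.
exact: Ck_comp_scalar Cf (Cg j).
Qed.

End Ck.

Lemma insub_set (T : Type) (A : set T) x (Ax : A x) :
  insub x = Some (SigSub (mem_set Ax) : A).
Proof. exact: (@insubT T (fun x => x \in A) A x (mem_set Ax)). Qed.

Section Diffeology.
Variable R : realType.

Record edom n := EDom {
  edom_set :> set 'rV[R]_n;
  edom_open : open edom_set }.

(* U stands for a type here: the subtype of its points.  The values outside U of
   the total function g are irrelevant. *)
Definition smooth m n (U : edom m) (f : U -> 'rV[R]_n) : Prop :=
  exists g : 'rV[R]_m -> 'rV[R]_n,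
    (forall k, Ck k U g) /\ (forall u : U, f u = g (val u)).

Record diffSpace := DiffSpace {
  dcar :> Type;
  plot : forall n (U : edom n), (U -> dcar) -> Prop;
  plot_cst : forall n (U : edom n) (x : dcar), plot (fun _ : U => x);
  plot_local : forall n (U : edom n) (p : U -> dcar),
    (forall u : U, exists (V : edom n) (VU : V `<=` U),
       (V : set _) (val u) /\ plot (p \o subfun VU)) -> plot p;
  plot_comp : forall m n (U : edom m) (V : edom n) (f : U -> V) (p : V -> dcar),
    smooth (val \o f) -> plot p -> plot (p \o f) }.

Definition is_smooth (X Y : diffSpace) (f : X -> Y) : Prop :=
  forall n (U : edom n) (p : U -> X), plot p -> plot (f \o p).

Record dMap (X Y : diffSpace) := DMap {
  dMap_fun :> X -> Y;
  dMapP : is_smooth dMap_fun }.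

Lemma dMap_eq (X Y : diffSpace) (f g : dMap X Y) : f =1 g -> f = g.
Proof.
case: f g => f sf [g sg] /= /funext fg; rewrite fg in sf *.
by congr DMap; exact: Prop_irrelevance.
Qed.

Lemma id_smooth (X : diffSpace) : is_smooth (id : X -> X).
Proof. by []. Qed.

Lemma comp_smooth (X Y Z : diffSpace) (g : dMap Y Z) (f : dMap X Y) :
  is_smooth (g \o f).
Proof. by move=> n U p pp; apply: (dMapP g); apply: (dMapP f). Qed.

Definition dMap_id X : dMap X X := DMap (@id_smooth X).
Definition dMap_comp X Y Z (g : dMap Y Z) (f : dMap X Y) : dMap X Z :=
  DMap (comp_smooth g f).

Lemma smoothE m n (U : edom m) (f : U -> 'rV[R]_n) :
  smooth f <-> forall k, Ck k U (fun x => oapp f 0 (insub x)).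
Proof.
split=> [[g [Cg fg]] k|Cf].
  apply: Ck_eq (Cg k) => [|x Ux]; first exact: edom_open.
  by rewrite (insub_set Ux) /= fg.
by exists (fun x => oapp f 0 (insub x)); split=> // u; rewrite valK.
Qed.

Lemma smooth_cst m n (U : edom m) c : smooth (fun _ : U => c : 'rV[R]_n).
Proof. by exists (fun=> c); split=> // k; apply: Ck_cst. Qed.

Lemma smooth_local m n (U : edom m) (f : U -> 'rV[R]_n) :
  (forall u : U, exists (V : edom m) (VU : V `<=` U),
     (V : set _) (val u) /\ smooth (f \o subfun VU)) -> smooth f.
Proof.
move=> loc; apply/smoothE => k; apply: Ck_local => x Ux.
have [V [VU [Vx [g [Cg fg]]]]] := loc (SigSub (mem_set Ux)).
exists V => //; apply: Ck_eq (Cg k) => [|y Vy]; first exact: edom_open.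
rewrite (insub_set (VU _ Vy)) /=.
rewrite -[y in LHS]/(val (SigSub (mem_set Vy) : V)) -fg /=.
by congr f; apply: val_inj.
Qed.

Lemma smooth_comp m n p (U : edom m) (V : edom n) (f : U -> V)
    (g : V -> 'rV[R]_p) : smooth (val \o f) -> smooth g -> smooth (g \o f).
Proof.
move=> [f' [Cf ff']] [g' [Cg gg']].
exists (g' \o f'); split=> [k|u /=]; last by rewrite gg' -ff'.
apply: (Ck_comp (V := V)) => // [||x Ux]; [exact: edom_open..|].
by rewrite -[x]/(val (SigSub (mem_set Ux) : U)) -ff'; apply: set_valP.
Qed.

Definition euclid n : diffSpace :=
  @DiffSpace 'rV[R]_n (fun m U p => smooth p) (fun m U c => smooth_cst U c)
    (@smooth_local ^~ n) (fun m k U V f p => @smooth_comp m k n U V f p).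

Section Sub.
Variables (X : diffSpace) (A : set X).

Definition sub_plot n (U : edom n) (p : U -> A) := plot (fun u => val (p u)).

Lemma sub_plot_cst n (U : edom n) (x : A) : sub_plot (fun _ : U => x).
Proof. exact: plot_cst. Qed.

Lemma sub_plot_local n (U : edom n) (p : U -> A) :
  (forall u : U, exists (V : edom n) (VU : V `<=` U),
     (V : set _) (val u) /\ sub_plot (p \o subfun VU)) -> sub_plot p.
Proof. by move=> loc; apply: plot_local => u; apply: loc. Qed.

Lemma sub_plot_comp m n (U : edom m) (V : edom n) (f : U -> V) (p : V -> A) :
  smooth (val \o f) -> sub_plot p -> sub_plot (p \o f).
Proof. by move=> sf sp; apply: (plot_comp sf sp). Qed.

Definition dsub : diffSpace := DiffSpace sub_plot_cst sub_plot_local sub_plot_comp.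
End Sub.

Section Prod.
Variables X Y : diffSpace.

Definition prod_plot n (U : edom n) (p : U -> X * Y) :=
  plot (fun u => (p u).1) /\ plot (fun u => (p u).2).

Lemma prod_plot_cst n (U : edom n) (x : X * Y) : prod_plot (fun _ : U => x).
Proof. by split; apply: plot_cst. Qed.

Lemma prod_plot_local n (U : edom n) (p : U -> X * Y) :
  (forall u : U, exists (V : edom n) (VU : V `<=` U),
     (V : set _) (val u) /\ prod_plot (p \o subfun VU)) -> prod_plot p.
Proof.
by move=> loc; split; apply: plot_local => u;
  have [V [VU [Vu [p1 p2]]]] := loc u; exists V, VU.
Qed.

Lemma prod_plot_comp m n (U : edom m) (V : edom n) (f : U -> V) (p : V -> X * Y) :
  smooth (val \o f) -> prod_plot p -> prod_plot (p \o f).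
Proof.
by move=> sf [p1 p2]; split; [apply: (plot_comp sf p1)|apply: (plot_comp sf p2)].
Qed.

Definition dprod : diffSpace := DiffSpace prod_plot_cst prod_plot_local prod_plot_comp.
End Prod.

(* Open sets of the D-topology, the final topology for all plots. *)
Definition dopen (X : diffSpace) (A : set X) : Prop :=
  forall n (U : edom n) (p : U -> X), plot p -> open (val @` (p @^-1` A)).

End Diffeology.

Section DiffBundles.
Variable R : realType.
Implicit Types X Y : diffSpace R.

(* MathComp's groupType is not used here: it would put a choiceType structure
   on the carrier. *)
Record diffGroup := DiffGroup {
  dg_space :> diffSpace R;
  dg_mul : dg_space -> dg_space -> dg_space;
  dg_one : dg_space;
  dg_inv : dg_space -> dg_space;
  dg_mul_smooth :
    @is_smooth R (dprod dg_space dg_space) dg_space (fun z => dg_mul z.1 z.2);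
  dg_inv_smooth : is_smooth dg_inv;
  dg_mulA : associative dg_mul;
  dg_mul1g : left_id dg_one dg_mul;
  dg_mulg1 : right_id dg_one dg_mul;
  dg_mulVg : left_inverse dg_one dg_inv dg_mul;
  dg_mulgV : right_inverse dg_one dg_inv dg_mul }.

Variable G : diffGroup.

(* Objects of the category DG. *)
Record dgSpace := DGSpace {
  dgs_space :> diffSpace R;
  dgs_act : dgs_space -> G -> dgs_space;
  dgs_act_smooth :
    @is_smooth R (dprod dgs_space G) dgs_space (fun z => dgs_act z.1 z.2);
  dgs_act1 : forall e, dgs_act e (dg_one G) = e;
  dgs_actM : forall e g h, dgs_act e (dg_mul g h) = dgs_act (dgs_act e g) h }.

(* Objects of the category DG/X, X with the trivial action. *)
Record dgOver (X : diffSpace R) := DGOver {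
  dgo_tot :> dgSpace;
  dgo_proj : dMap dgo_tot X;
  dgo_projM : forall e g, dgo_proj (dgs_act e g) = dgo_proj e }.

(* Isomorphism in DG/X; the inverse of an equivariant map over X is
   automatically equivariant and over X. *)
Definition dgo_iso X (P Q : dgOver X) : Prop :=
  exists (f : dMap P Q) (f' : dMap Q P),
    [/\ cancel f f', cancel f' f,
        forall e g, f (dgs_act e g) = dgs_act (f e) g
      & forall e, dgo_proj Q (f e) = dgo_proj P e].

Section Trivial.
Variable X : diffSpace R.

Definition triv_act (z : dprod X G) (h : G) : dprod X G := (z.1, dg_mul z.2 h).

Lemma triv_act_smooth : @is_smooth R (dprod (dprod X G) G) (dprod X G)
  (fun z => triv_act z.1 z.2).
Proof.
move=> n U p [[p1 p2] p3]; split=> //=.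
exact: (@dg_mul_smooth G n U (fun u => ((p u).1.2, (p u).2))).
Qed.

Lemma triv_act1 z : triv_act z (dg_one G) = z.
Proof. by case: z => x g; rewrite /triv_act /= dg_mulg1. Qed.

Lemma triv_actM z g h : triv_act z (dg_mul g h) = triv_act (triv_act z g) h.
Proof. by case: z => x k; rewrite /triv_act /= dg_mulA. Qed.

Lemma fst_smooth Y : @is_smooth R (dprod X Y) X fst.
Proof. by move=> n U p []. Qed.

Lemma triv_projM (z : dprod X G) (g : G) : (triv_act z g).1 = z.1.
Proof. by []. Qed.

Definition dgo_triv : dgOver X :=
  @DGOver X (DGSpace triv_act_smooth triv_act1 triv_actM)
    (DMap (@fst_smooth G)) triv_projM.
End Trivial.

Section Restriction.
Variables (X : diffSpace R) (P : dgOver X) (A : set X).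

Definition restr_tot : diffSpace R := dsub (dgo_proj P @^-1` A).

Lemma restr_actP (e : restr_tot) (g : G) :
  (dgo_proj P @^-1` A) (dgs_act (val e) g).
Proof. by rewrite /preimage /= dgo_projM; apply: (set_valP e). Qed.

Definition restr_act (e : restr_tot) (g : G) : restr_tot :=
  SigSub (mem_set (restr_actP e g)).

Lemma restr_act_smooth :
  @is_smooth R (dprod restr_tot G) restr_tot (fun z => restr_act z.1 z.2).
Proof.
move=> n U p [p1 p2].
exact: (@dgs_act_smooth P n U (fun u => (val (p u).1, (p u).2))).
Qed.

Lemma restr_act1 e : restr_act e (dg_one G) = e.
Proof. by apply: val_inj; rewrite /= dgs_act1. Qed.

Lemma restr_actM e g h : restr_act e (dg_mul g h) = restr_act (restr_act e g) h.
Proof. by apply: val_inj; rewrite /= dgs_actM. Qed.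

Lemma restr_projP (e : restr_tot) : A (dgo_proj P (val e)).
Proof. exact: (set_valP e). Qed.

Definition restr_proj (e : restr_tot) : dsub A :=
  SigSub (mem_set (restr_projP e)).

Lemma restr_proj_smooth : is_smooth restr_proj.
Proof. by move=> n U p pp; apply: (dMapP (dgo_proj P)). Qed.

Lemma restr_projM e g : restr_proj (restr_act e g) = restr_proj e.
Proof. by apply: val_inj; rewrite /= dgo_projM. Qed.

Definition dgo_restr : dgOver (dsub A) :=
  @DGOver (dsub A) (DGSpace restr_act_smooth restr_act1 restr_actM)
    (DMap restr_proj_smooth) restr_projM.
End Restriction.

Section Pullback.
Variables (X Y : diffSpace R) (f : dMap Y X) (P : dgOver X).

Definition pull_tot : diffSpace R :=
  @dsub R (dprod Y P) [set z | f z.1 = dgo_proj P z.2].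

Lemma pull_actP (z : pull_tot) (g : G) :
  f (val z).1 = dgo_proj P (dgs_act (val z).2 g).
Proof. by rewrite dgo_projM; apply: (set_valP z). Qed.

Definition pull_act (z : pull_tot) (g : G) : pull_tot :=
  @SigSub _ _ [set z : Y * P | f z.1 = dgo_proj P z.2]
    ((val z).1, dgs_act (val z).2 g) (mem_set (pull_actP z g)).

Lemma pull_act_smooth :
  @is_smooth R (dprod pull_tot G) pull_tot (fun z => pull_act z.1 z.2).
Proof.
move=> n U p [[p1 p2] p3]; split=> //=.
exact: (@dgs_act_smooth P n U (fun u => ((val (p u).1).2, (p u).2))).
Qed.

Lemma pull_act1 z : pull_act z (dg_one G) = z.
Proof. by apply: val_inj; rewrite /= dgs_act1 -surjective_pairing. Qed.

Lemma pull_actM z g h : pull_act z (dg_mul g h) = pull_act (pull_act z g) h.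
Proof. by apply: val_inj; rewrite /= dgs_actM. Qed.

Lemma pull_proj_smooth : @is_smooth R pull_tot Y (fun z => (val z).1).
Proof. by move=> n U p []. Qed.

Lemma pull_projM (z : pull_tot) (g : G) : (val (pull_act z g)).1 = (val z).1.
Proof. by []. Qed.

Definition dgo_pull : dgOver Y :=
  @DGOver Y (DGSpace pull_act_smooth pull_act1 pull_actM)
    (DMap pull_proj_smooth) pull_projM.
End Pullback.

Definition locally_trivial X (P : dgOver X) : Prop :=
  exists (I : Type) (A : I -> set X),
    [/\ forall i, dopen (A i), \bigcup_i A i = setT
      & forall i, dgo_iso (dgo_restr P (A i)) (dgo_triv (dsub (A i)))].

(* A plot U -> X is a smooth map on U with the sub-diffeology of R^n. *)
Lemma plot_smooth X n (U : edom R n) (p : U -> X) :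
  plot p -> @is_smooth R (@dsub R (euclid R n) U) X p.
Proof. by move=> pp m V q sq; apply: (plot_comp sq pp). Qed.

Definition plot_dMap X n (U : edom R n) (p : U -> X) (pp : plot p) :
  dMap (@dsub R (euclid R n) U) X := DMap (plot_smooth pp).

Definition diff_principal X (P : dgOver X) : Prop :=
  forall n (U : edom R n) (p : U -> X) (pp : plot p),
    locally_trivial (dgo_pull (plot_dMap pp) P).

(* Commutative squares in DG, the bases carrying the trivial action. *)
Record dgSquare X Y (P : dgOver X) (Q : dgOver Y) := DGSquare {
  dsq_top : dMap P Q;
  dsq_base : dMap X Y;
  dsq_act : forall e g, dsq_top (dgs_act e g) = dgs_act (dsq_top e) g;
  dsq_comm : forall e, dgo_proj Q (dsq_top e) = dsq_base (dgo_proj P e) }.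

End DiffBundles.

(* Simplex category: objects n : nat standing for the ordinal [n] = {0..n},
   morphisms the nondecreasing maps. *)
Definition simp_op m n := {omorphism 'I_m.+1 -> 'I_n.+1}.
Definition simp_id n : simp_op n n := idfun.
Definition simp_comp m n p (g : simp_op n p) (f : simp_op m n) : simp_op m p :=
  g \o f.

Lemma simp_op_eq m n (f g : simp_op m n) : f =1 g -> f = g.
Proof.
case: f g => f [[pf]] [g [[pg]]] /= /funext fg; rewrite fg in pf *.
by congr (Order.OrderMorphism.Pack _); congr (Order.OrderMorphism.Class _);
  congr (Order.isOrderMorphism.Axioms_ _); exact: Prop_irrelevance.
Qed.

Record sSet := SSet {
  simplex :> nat -> Type;
  sop : forall m n, simp_op m n -> simplex n -> simplex m;
  sop_id : forall n x, sop (simp_id n) x = x;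
  sop_comp : forall m n p (g : simp_op n p) (f : simp_op m n) x,
    sop (simp_comp g f) x = sop f (sop g x) }.

Record sMap (K L : sSet) := SMap {
  sMap_at :> forall n, K n -> L n;
  sMap_sop : forall m n (a : simp_op m n) (x : K n),
    sMap_at (sop a x) = sop a (sMap_at x) }.

Lemma sMap_eq K L (f g : sMap K L) : (forall n, f n =1 g n) -> f = g.
Proof.
case: f g => f sf [g sg] /= fg.
have {}fg : f = g by apply/functional_extensionality_dep => n; apply/funext/fg.
by rewrite fg in sf *; congr SMap; exact: Prop_irrelevance.
Qed.

Definition sMap_id K : sMap K K :=
  @SMap K K (fun n x => x) (fun m n a x => erefl).

Lemma sMap_compP K L M (g : sMap L M) (f : sMap K L) m n (a : simp_op m n) x :
  g m (f m (sop a x)) = sop a (g n (f n x)).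
Proof. by rewrite !sMap_sop. Qed.

Definition sMap_comp K L M (g : sMap L M) (f : sMap K L) : sMap K M :=
  SMap (sMap_compP g f).

Section StandardSimplex.
Variable p : nat.

Lemma std_simplex_id n (x : simp_op n p) : simp_comp x (simp_id n) = x.
Proof. exact: simp_op_eq. Qed.

Lemma std_simplex_comp l m n (g : simp_op m n) (f : simp_op l m)
  (x : simp_op n p) : simp_comp x (simp_comp g f) = simp_comp (simp_comp x g) f.
Proof. exact: simp_op_eq. Qed.

Definition std_simplex : sSet :=
  @SSet (fun n => simp_op n p) (fun m n a x => simp_comp x a)
    std_simplex_id std_simplex_comp.
End StandardSimplex.

Record sGroup := SGroup {
  sg_space :> sSet;
  sg_mul : forall n, sg_space n -> sg_space n -> sg_space n;
  sg_one : forall n, sg_space n;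
  sg_inv : forall n, sg_space n -> sg_space n;
  sg_mul_sop : forall m n (a : simp_op m n) x y,
    sop a (sg_mul x y) = sg_mul (sop a x) (sop a y);
  sg_one_sop : forall m n (a : simp_op m n), sop a (sg_one n) = sg_one m;
  sg_inv_sop : forall m n (a : simp_op m n) x,
    sop a (sg_inv x) = sg_inv (sop a x);
  sg_mulA : forall n, associative (@sg_mul n);
  sg_mul1g : forall n, left_id (sg_one n) (@sg_mul n);
  sg_mulg1 : forall n, right_id (sg_one n) (@sg_mul n);
  sg_mulVg : forall n, left_inverse (sg_one n) (@sg_inv n) (@sg_mul n);
  sg_mulgV : forall n, right_inverse (sg_one n) (@sg_inv n) (@sg_mul n) }.

Section SimplicialBundles.
Variable H : sGroup.

(* Objects of the category SH. *)
Record sgSpace := SGSpace {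
  sgs_space :> sSet;
  sgs_act : forall n, sgs_space n -> H n -> sgs_space n;
  sgs_act_sop : forall m n (a : simp_op m n) e h,
    sop a (sgs_act e h) = sgs_act (sop a e) (sop a h);
  sgs_act1 : forall n (e : sgs_space n), sgs_act e (sg_one H n) = e;
  sgs_actM : forall n (e : sgs_space n) g h,
    sgs_act e (sg_mul g h) = sgs_act (sgs_act e g) h }.

(* Objects of the category SH/K, K with the trivial action. *)
Record sgOver (K : sSet) := SGOver {
  sgo_tot :> sgSpace;
  sgo_proj : sMap sgo_tot K;
  sgo_projM : forall n (e : sgo_tot n) h,
    sgo_proj n (sgs_act e h) = sgo_proj n e }.

Definition sgo_iso K (E F : sgOver K) : Prop :=
  exists (f : sMap E F) (f' : sMap F E),
    [/\ forall n, cancel (f n) (f' n), forall n, cancel (f' n) (f n),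
        forall n (e : E n) h, f n (sgs_act e h) = sgs_act (f n e) h
      & forall n (e : E n), sgo_proj F n (f n e) = sgo_proj E n e].

Section Trivial.
Variable K : sSet.

Lemma sprod_id n (z : K n * H n) : (sop (simp_id n) z.1, sop (simp_id n) z.2) = z.
Proof. by rewrite !sop_id -surjective_pairing. Qed.

Lemma sprod_comp m n p (g : simp_op n p) (f : simp_op m n) (z : K p * H p) :
  (sop (simp_comp g f) z.1, sop (simp_comp g f) z.2) =
  (sop f (sop g z.1), sop f (sop g z.2)).
Proof. by rewrite !sop_comp. Qed.

Definition striv_tot : sSet :=
  @SSet (fun n => K n * H n)%type (fun m n a z => (sop a z.1, sop a z.2))
    sprod_id sprod_comp.

Definition striv_act n (z : striv_tot n) (h : H n) : striv_tot n :=
  (z.1, sg_mul z.2 h).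

Lemma striv_act_sop m n (a : simp_op m n) (z : striv_tot n) h :
  sop a (striv_act z h) = striv_act (sop a z) (sop a h).
Proof. by rewrite /striv_act /= sg_mul_sop. Qed.

Lemma striv_act1 n (z : striv_tot n) : striv_act z (sg_one H n) = z.
Proof. by rewrite /striv_act sg_mulg1 -surjective_pairing. Qed.

Lemma striv_actM n (z : striv_tot n) g h :
  striv_act z (sg_mul g h) = striv_act (striv_act z g) h.
Proof. by rewrite /striv_act /= sg_mulA. Qed.

Definition striv_proj : sMap striv_tot K :=
  @SMap striv_tot K (fun n z => z.1) (fun m n a z => erefl).

Lemma striv_projM n (z : striv_tot n) (h : H n) :
  striv_proj n (striv_act z h) = striv_proj n z.
Proof. by []. Qed.

Definition sgo_triv : sgOver K :=
  @SGOver K (SGSpace striv_act_sop striv_act1 striv_actM) striv_proj striv_projM.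
End Trivial.

Section Pullback.
Variables (K L : sSet) (k : sMap L K) (E : sgOver K).

Definition spull_simplex n := {z : L n * E n | k n z.1 = sgo_proj E n z.2}.

Lemma spull_eq n (z z' : spull_simplex n) : sval z = sval z' -> z = z'.
Proof.
case: z z' => z pz [z' pz'] /= zz'; rewrite zz' in pz *.
by congr exist; apply: Prop_irrelevance.
Qed.

Lemma spull_sopP m n (a : simp_op m n) (z : spull_simplex n) :
  k m (sop a (sval z).1) = sgo_proj E m (sop a (sval z).2).
Proof. by rewrite !sMap_sop (svalP z). Qed.

Definition spull_sop m n (a : simp_op m n) (z : spull_simplex n) :
  spull_simplex m := exist _ (sop a (sval z).1, sop a (sval z).2) (spull_sopP a z).

Lemma spull_id n (z : spull_simplex n) : spull_sop (simp_id n) z = z.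
Proof. by apply: spull_eq; rewrite /= !sop_id -surjective_pairing. Qed.

Lemma spull_comp m n p (g : simp_op n p) (f : simp_op m n) z :
  spull_sop (simp_comp g f) z = spull_sop f (spull_sop g z).
Proof. by apply: spull_eq; rewrite /= !sop_comp. Qed.

Definition spull_tot : sSet := SSet spull_id spull_comp.

Lemma spull_actP n (z : spull_tot n) (h : H n) :
  k n (sval z).1 = sgo_proj E n (sgs_act (sval z).2 h).
Proof. by rewrite sgo_projM (svalP z). Qed.

Definition spull_act n (z : spull_tot n) (h : H n) : spull_tot n :=
  exist _ ((sval z).1, sgs_act (sval z).2 h) (spull_actP z h).

Lemma spull_act_sop m n (a : simp_op m n) (z : spull_tot n) h :
  sop a (spull_act z h) = spull_act (sop a z) (sop a h).
Proof. by apply: spull_eq; rewrite /= sgs_act_sop. Qed.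

Lemma spull_act1 n (z : spull_tot n) : spull_act z (sg_one H n) = z.
Proof. by apply: spull_eq; rewrite /= sgs_act1 -surjective_pairing. Qed.

Lemma spull_actM n (z : spull_tot n) g h :
  spull_act z (sg_mul g h) = spull_act (spull_act z g) h.
Proof. by apply: spull_eq; rewrite /= sgs_actM. Qed.

Definition spull_proj : sMap spull_tot L :=
  @SMap spull_tot L (fun n z => (sval z).1) (fun m n a z => erefl).

Lemma spull_projM n (z : spull_tot n) (h : H n) :
  spull_proj n (spull_act z h) = spull_proj n z.
Proof. by []. Qed.

Definition sgo_pull : sgOver L :=
  @SGOver L (SGSpace spull_act_sop spull_act1 spull_actM) spull_proj spull_projM.
End Pullback.

Definition simp_principal K (E : sgOver K) : Prop :=
  forall p (k : sMap (std_simplex p) K),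
    sgo_iso (sgo_pull k E) (sgo_triv (std_simplex p)).

Record sgSquare K L (E : sgOver K) (F : sgOver L) := SGSquare {
  ssq_top : sMap E F;
  ssq_base : sMap K L;
  ssq_act : forall n (e : E n) h,
    ssq_top n (sgs_act e h) = sgs_act (ssq_top n e) h;
  ssq_comm : forall n (e : E n),
    sgo_proj F n (ssq_top n e) = ssq_base n (sgo_proj E n e) }.

End SimplicialBundles.

Record category := Category {
  cat_obj :> Type;
  cat_hom : cat_obj -> cat_obj -> Type;
  cat_id : forall x, cat_hom x x;
  cat_comp : forall x y z, cat_hom y z -> cat_hom x y -> cat_hom x z;
  cat_compA : forall x y z w (h : cat_hom z w) (g : cat_hom y z) (f : cat_hom x y),
    cat_comp h (cat_comp g f) = cat_comp (cat_comp h g) f;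
  cat_comp1f : forall x y (f : cat_hom x y), cat_comp (cat_id y) f = f;
  cat_compf1 : forall x y (f : cat_hom x y), cat_comp f (cat_id x) = f }.

Record functor (C D : category) := Functor {
  fun_obj :> C -> D;
  fun_hom : forall x y : C, cat_hom x y -> cat_hom (fun_obj x) (fun_obj y);
  fun_id : forall x, fun_hom (cat_id x) = cat_id (fun_obj x);
  fun_comp : forall x y z (g : cat_hom y z) (f : cat_hom x y),
    fun_hom (cat_comp g f) = cat_comp (fun_hom g) (fun_hom f) }.

Definition faithful (C D : category) (F : functor C D) : Prop :=
  forall x y : C, injective (@fun_hom C D F x y).

Definition full_subcat (C : category) (P : C -> Prop) : category :=
  @Category {x : C | P x} (fun x y => cat_hom (sval x) (sval y))
    (fun x => cat_id (sval x)) (fun x y z g f => cat_comp g f)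
    (fun x y z w h g f => cat_compA h g f) (fun x y f => cat_comp1f f)
    (fun x y f => cat_compf1 f).

(* The functor induced between full subcategories by a functor F that maps the
   objects of the first one into the second one. *)
Definition restr_functor (C D : category) (F : functor C D)
    (P : C -> Prop) (Q : D -> Prop) (PQ : forall x, P x -> Q (F x)) :
  functor (full_subcat P) (full_subcat Q) :=
  @Functor (full_subcat P) (full_subcat Q)
    (fun x => exist Q (F (sval x)) (PQ (sval x) (svalP x)))
    (fun x y f => fun_hom F f) (fun x => fun_id F (sval x))
    (fun x y z g f => fun_comp F g f).

Definition diff_cat (R : realType) : category.
Proof.
by refine (@Category (diffSpace R) (@dMap R) (@dMap_id R) (@dMap_comp R) _ _ _)
  => *; apply: dMap_eq.
Defined.

Definition sset_cat : category.
Proof.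
by refine (@Category sSet sMap sMap_id sMap_comp _ _ _) => *; apply: sMap_eq.
Defined.

Section BundleCategories.

Section Diff.
Variables (R : realType) (G : diffGroup R).

Lemma dgSquare_eq (X Y : diffSpace R) (P : dgOver G X) (Q : dgOver G Y)
  (s t : dgSquare P Q) :
  dsq_top s = dsq_top t -> dsq_base s = dsq_base t -> s = t.
Proof.
case: s t => a b p q [c d p' q'] /= ac bd.
by rewrite ac bd in p q *; congr DGSquare; apply: Prop_irrelevance.
Qed.

Definition dgSquare_id (X : diffSpace R) (P : dgOver G X) : dgSquare P P :=
  @DGSquare R G X X P P (dMap_id P) (dMap_id X)
    (fun e g => erefl) (fun e => erefl).

Section Comp.
Variables (X Y Z : diffSpace R) (P : dgOver G X) (Q : dgOver G Y) (S : dgOver G Z).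
Variables (t : dgSquare Q S) (s : dgSquare P Q).

Lemma dgSquare_comp_act e g :
  dsq_top t (dsq_top s (dgs_act e g)) = dgs_act (dsq_top t (dsq_top s e)) g.
Proof. by rewrite !dsq_act. Qed.

Lemma dgSquare_comp_comm e :
  dgo_proj S (dsq_top t (dsq_top s e)) = dsq_base t (dsq_base s (dgo_proj P e)).
Proof. by rewrite !dsq_comm. Qed.

Definition dgSquare_comp : dgSquare P S :=
  @DGSquare R G X Z P S (dMap_comp (dsq_top t) (dsq_top s))
    (dMap_comp (dsq_base t) (dsq_base s)) dgSquare_comp_act dgSquare_comp_comm.
End Comp.

(* Objects of DG over arbitrary diffeological spaces, with commutative squares
   in DG as morphisms. *)
Definition dgOver_cat : category.
Proof.
by refine (@Category {X : diffSpace R & dgOver G X}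
  (fun P Q => dgSquare (projT2 P) (projT2 Q)) (fun P => dgSquare_id (projT2 P))
  (fun P Q S t s => dgSquare_comp t s) _ _ _) => *;
  apply: dgSquare_eq; apply: dMap_eq.
Defined.

Definition is_diff_principal (P : dgOver_cat) : Prop :=
  diff_principal (projT2 P).
Definition diff_principal_cat : category := full_subcat is_diff_principal.
End Diff.

Section Simp.
Variable H : sGroup.

Lemma sgSquare_eq (K L : sSet) (E : sgOver H K) (F : sgOver H L)
  (s t : sgSquare E F) :
  ssq_top s = ssq_top t -> ssq_base s = ssq_base t -> s = t.
Proof.
case: s t => a b p q [c d p' q'] /= ac bd.
by rewrite ac bd in p q *; congr SGSquare; apply: Prop_irrelevance.
Qed.

Definition sgSquare_id (K : sSet) (E : sgOver H K) : sgSquare E E :=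
  @SGSquare H K K E E (sMap_id E) (sMap_id K)
    (fun n e h => erefl) (fun n e => erefl).

Section Comp.
Variables (K L M : sSet) (E : sgOver H K) (F : sgOver H L) (J : sgOver H M).
Variables (t : sgSquare F J) (s : sgSquare E F).

Lemma sgSquare_comp_act n (e : E n) h :
  ssq_top t n (ssq_top s n (sgs_act e h)) =
  sgs_act (ssq_top t n (ssq_top s n e)) h.
Proof. by rewrite !ssq_act. Qed.

Lemma sgSquare_comp_comm n (e : E n) :
  sgo_proj J n (ssq_top t n (ssq_top s n e)) =
  ssq_base t n (ssq_base s n (sgo_proj E n e)).
Proof. by rewrite !ssq_comm. Qed.

Definition sgSquare_comp : sgSquare E J :=
  @SGSquare H K M E J (sMap_comp (ssq_top t) (ssq_top s))
    (sMap_comp (ssq_base t) (ssq_base s)) sgSquare_comp_act sgSquare_comp_comm.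
End Comp.

Definition sgOver_cat : category.
Proof.
by refine (@Category {K : sSet & sgOver H K}
  (fun E F => sgSquare (projT2 E) (projT2 F)) (fun E => sgSquare_id (projT2 E))
  (fun E F J t s => sgSquare_comp t s) _ _ _) => *;
  apply: sgSquare_eq; apply: sMap_eq.
Defined.

Definition is_simp_principal (E : sgOver_cat) : Prop :=
  simp_principal (projT2 E).
Definition simp_principal_cat : category := full_subcat is_simp_principal.
End Simp.

End BundleCategories.

Section Saff.
Variable R : realType.

Definition affine_set p : set 'rV[R]_p.+1 := [set x | \sum_i x 0 i = 1].
Definition affine p : diffSpace R := @dsub R (euclid R p.+1) (@affine_set p).

Section AffineMap.
Variables (m n : nat) (a : simp_op m n).

(* The affine map A^m -> A^n induced by a sends the vertex e_i to e_(a i). *)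
Lemma affine_opP (x : affine m) :
  affine_set (\row_j \sum_(i | a i == j) val x 0 i : 'rV[R]_n.+1).
Proof.
rewrite /affine_set /=; under eq_bigr do rewrite mxE.
rewrite -[RHS](set_valP x) [in RHS](partition_big a xpredT) //=.
Qed.

Definition affine_op (x : affine m) : affine n :=
  SigSub (mem_set (affine_opP x)).

Lemma affine_op_smooth : is_smooth affine_op.
Proof.
move=> k U p [g [Cg pg]].
exists (fun x => \row_j \sum_(i | a i == j) g x 0 i); split=> [l|u]; last first.
  by apply/rowP => j; rewrite !mxE -pg.
apply/Ck_coordP => [|j]; first exact: edom_open.
rewrite (_ : (fun x => _) = \sum_i (if a i == j then (fun x => g x 0 i) else fun=> 0)).
  apply: Ck_sum => [|i]; first exact: edom_open.
  case: ifP => _; last exact: Ck_cst.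
  have /(Ck_coordP _ _ (@edom_open _ _ U)) := Cg l; exact.
apply/funext => x; rewrite mxE fct_sumE big_mkcond /=.
by apply: eq_bigr => i _; case: ifP.
Qed.

Definition affine_map : dMap (affine m) (affine n) := DMap affine_op_smooth.
End AffineMap.

Lemma affine_map_id n (x : affine n) : affine_map (simp_id n) x = x.
Proof.
by apply: val_inj; apply/rowP => j; rewrite mxE /= (big_pred1 j).
Qed.

Lemma affine_map_comp m n p (g : simp_op n p) (f : simp_op m n) (x : affine m) :
  affine_map (simp_comp g f) x = affine_map g (affine_map f x).
Proof.
apply: val_inj; apply/rowP => j; rewrite !mxE /=.
under [RHS]eq_bigr do rewrite mxE.
rewrite (partition_big f (fun i => g i == j)) //=.
apply: eq_bigr => i gij; apply: eq_bigl => l /=.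
by apply: andb_idl => /eqP ->.
Qed.

Section Obj.
Variable X : diffSpace R.

Lemma saff_id n (s : dMap (affine n) X) :
  dMap_comp s (affine_map (simp_id n)) = s.
Proof. by apply: dMap_eq => x; apply: (congr1 s (affine_map_id x)). Qed.

Lemma saff_comp m n p (g : simp_op n p) (f : simp_op m n)
    (s : dMap (affine p) X) :
  dMap_comp s (affine_map (simp_comp g f)) =
  dMap_comp (dMap_comp s (affine_map g)) (affine_map f).
Proof. by apply: dMap_eq => x; apply: (congr1 s (affine_map_comp g f x)). Qed.

Definition saff : sSet :=
  @SSet (fun n => dMap (affine n) X) (fun m n a s => dMap_comp s (affine_map a))
    saff_id saff_comp.
End Obj.

Lemma saff_map_sop (X Y : diffSpace R) (f : dMap X Y) m n (a : simp_op m n)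
    (s : saff X n) :
  dMap_comp f (sop a s) = sop a (dMap_comp f s : saff Y n).
Proof. exact: dMap_eq. Qed.

Definition saff_map (X Y : diffSpace R) (f : dMap X Y) : sMap (saff X) (saff Y) :=
  @SMap (saff X) (saff Y) (fun n s => dMap_comp f s) (saff_map_sop f).

Definition saff_functor : functor (diff_cat R) sset_cat.
Proof.
by refine (@Functor (diff_cat R) sset_cat saff saff_map _ _) => *;
  apply: sMap_eq => n s; apply: dMap_eq.
Defined.

Section Group.
Variable G : diffGroup R.

Lemma saff_mul_smooth n (s t : saff G n) :
  @is_smooth R (affine n) G (fun x => dg_mul (s x) (t x)).
Proof.
move=> k U p pp; apply: (@dg_mul_smooth R G k U (fun u => (s (p u), t (p u)))).
by split; apply: dMapP.
Qed.

Definition saff_mul n (s t : saff G n) : saff G n := DMap (saff_mul_smooth s t).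

Lemma saff_one_smooth n : @is_smooth R (affine n) G (fun=> dg_one G).
Proof. by move=> k U p _; apply: plot_cst. Qed.

Definition saff_one n : saff G n := DMap (@saff_one_smooth n).

Definition saff_inv n (s : saff G n) : saff G n :=
  dMap_comp (DMap (@dg_inv_smooth R G)) s.

Definition saff_group : sGroup.
Proof.
refine (@SGroup (saff G) saff_mul saff_one saff_inv _ _ _ _ _ _ _ _).
1-3: by move=> *; apply: dMap_eq.
- by move=> n s t u; apply: dMap_eq => x; apply: dg_mulA.
- by move=> n s; apply: dMap_eq => x; apply: dg_mul1g.
- by move=> n s; apply: dMap_eq => x; apply: dg_mulg1.
- by move=> n s; apply: dMap_eq => x; apply: dg_mulVg.
- by move=> n s; apply: dMap_eq => x; apply: dg_mulgV.
Defined.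

Section Space.
Variable P : dgSpace G.

Lemma saff_act_smooth n (s : saff P n) (t : saff G n) :
  @is_smooth R (affine n) P (fun x => dgs_act (s x) (t x)).
Proof.
move=> k U p pp; apply: (@dgs_act_smooth R G P k U (fun u => (s (p u), t (p u)))).
by split; apply: dMapP.
Qed.

Definition saff_act n (s : saff P n) (t : saff_group n) : saff P n :=
  DMap (saff_act_smooth s t).

Definition saff_space : sgSpace saff_group.
Proof.
refine (@SGSpace saff_group (saff P) saff_act _ _ _).
- by move=> *; apply: dMap_eq.
- by move=> n s; apply: dMap_eq => x; apply: dgs_act1.
- by move=> n s g h; apply: dMap_eq => x; apply: dgs_actM.
Defined.
End Space.

Lemma saff_projM (X : diffSpace R) (P : dgOver G X) n (s : saff_space P n)
    (t : saff_group n) :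
  saff_map (dgo_proj P) n (sgs_act s t) = saff_map (dgo_proj P) n s.
Proof. by apply: dMap_eq => x /=; rewrite dgo_projM. Qed.

Definition saff_over (X : diffSpace R) (P : dgOver G X) :
    sgOver saff_group (saff X) :=
  @SGOver saff_group (saff X) (saff_space P) (saff_map (dgo_proj P))
    (@saff_projM X P).

Section Square.
Variables (X Y : diffSpace R) (P : dgOver G X) (Q : dgOver G Y).
Variable s : dgSquare P Q.

Lemma saff_square_act n (e : saff_over P n) (h : saff_group n) :
  saff_map (dsq_top s) n (sgs_act e h) =
  @sgs_act saff_group (saff_over Q) n (saff_map (dsq_top s) n e) h.
Proof. by apply: dMap_eq => x /=; rewrite dsq_act. Qed.

Lemma saff_square_comm n (e : saff_over P n) :
  sgo_proj (saff_over Q) n (saff_map (dsq_top s) n e) =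
  saff_map (dsq_base s) n (sgo_proj (saff_over P) n e).
Proof. by apply: dMap_eq => x /=; rewrite dsq_comm. Qed.

Definition saff_square : sgSquare (saff_over P) (saff_over Q) :=
  @SGSquare saff_group (saff X) (saff Y) (saff_over P) (saff_over Q)
    (saff_map (dsq_top s)) (saff_map (dsq_base s))
    saff_square_act saff_square_comm.
End Square.

(* Acts by [saff_functor] on total spaces, on bases, and on the two components
   of a square. *)
Definition saff_over_functor : functor (dgOver_cat G) (sgOver_cat saff_group).
Proof.
by refine (@Functor (dgOver_cat G) (sgOver_cat saff_group)
  (fun P => existT _ (saff (projT1 P)) (saff_over (projT2 P)))
  (fun P Q s => saff_square s) _ _) => *;
  apply: sgSquare_eq; apply: sMap_eq => n t; apply: dMap_eq.
Defined.
End Group.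

End Saff.

(* Main.v *)
Require Import Defs.
From mathcomp Require Import all_boot all_order all_algebra.
From mathcomp Require Import all_classical all_reals all_analysis.
From mathcomp Require Import ring lra.
Import Order.TTheory GRing.Theory Num.Theory.
Import numFieldNormedType.Exports.
Set Implicit Arguments.
Unset Strict Implicit.
Unset Printing Implicit Defensive.
Local Open Scope classical_set_scope.
Local Open Scope ring_scope.

(** Both notions of principal bundle are unwound to the same three properties of
    an object [P] over [X], read on two kinds of test spaces: the action is free;
    maps into [X] lift to [P]; two maps into [P] with the same projection differ
    by a unique map into [G].

    On the diffeological side the test maps are germs of plots, and lifts are
    only local ([smooth_torsor]): a local lift [s] of a plot is a local
    trivialization, [(y, g)] corresponding to [s y * g], and conversely
    ([smooth_torsor_of_principal], [principal_of_smooth_torsor]).  On the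
    simplicial side the test maps are smooth maps on the affine spaces [A^n], and
    lifts are global ([affine_torsor]): by the Yoneda lemma a trivialization over
    [Delta[n] -> S(X)] is a lift of the corresponding map [A^n -> X]
    ([affine_torsor_of_simplicial], [simplicial_of_affine_torsor]).

    From [A^n] to plots: every point of an open set [U] of [R^n] has a
    neighborhood that factors smoothly through a map [A^n -> U]
    ([affine_chart]), because the identity of a small ball extends to a smooth
    map of [R^n] into a larger ball.  Hence lifts and differences over [A^n]
    give local ones over [U], and smoothness is local.

    From plots to [A^n], the point is that local lifts over [R^n] can be glued to
    a global one ([global_lift]), for an arbitrary diffeological group [G].  Let
    [s1] and [s2] be lifts over open sets [A1] and [A2], with [s1 = s2 * g] on
    the intersection.  If [r] is a smooth map from [A2] into the intersection,
    then [s2 * (g o r)] is a lift over the whole of [A2], and it agrees with [s1]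
    wherever [r] is the identity.  For two boxes with a common face the map [r]
    clamps one coordinate; this glues lifts over adjacent boxes, so that
    compactness of intervals, used one coordinate at a time, gives lifts over all
    boxes.  For two concentric cubes [r] clamps all coordinates, and lifts over
    an exhausting sequence of cubes are corrected successively so that the
    sequence becomes locally stationary.

    The functor is faithful because a smooth map is determined by its values, and
    hence by its effect on constant simplices. *)

Local Notation "e ** g" := (dgs_act e g) (at level 40, left associativity).

(** * Smooth clamping functions *)

Section Calculus.
Variable R : realType.

Lemma comp_scalar_derive (V : normedModType R) (g : V -> R) (f : R -> R) x df :
  differentiable g x -> is_derive (g x) 1 f df ->
  differentiable (f \o g) x /\ forall v, 'D_v (f \o g) x = 'D_v g x * df.
Proof.
move=> dg [/derivable1_diffP dfg dfE].
have dfog : differentiable (f \o g) x by apply: differentiable_comp.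
split=> // v; rewrite (deriveE _ dfog) diff_comp //= (deriveE _ dg).
by rewrite diff1E // derive1E dfE.
Qed.

Lemma Ck_inv (V : normedModType R) k (U : set V) (g : V -> R) : open U ->
  (forall x, U x -> g x != 0) -> Ck k U g -> Ck k U (fun x => (g x)^-1).
Proof.
move=> oU g0; elim: k => [|k IH] Cg.
  by move=> x Ux; apply: continuousV; [apply: g0|apply: Cg].
have Cig := IH (CkS Cg); case: Cg => dg Dg.
have dV x : U x -> differentiable (GRing.inv \o g) x /\
    forall v, 'D_v (GRing.inv \o g) x = 'D_v g x * - (g x) ^- 2.
  move=> Ux; apply: comp_scalar_derive; first exact: dg.
  have := @is_deriveV R id (g x) 1 1 (g0 _ Ux) (is_derive_id _ _).
  by rewrite [_ *: _]mulr1.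
split=> [x Ux|v]; first by case: (dV x Ux).
apply: (@Ck_eq R _ _ _ _
  ('D_v g * (cst (-1) * ((fun x => (g x)^-1) * (fun x => (g x)^-1))))) => //.
  move=> x Ux; case: (dV x Ux) => _ /(_ v) /= ->.
  rewrite -[LHS]/('D_v g x * (-1 * ((g x)^-1 * (g x)^-1))).
  by rewrite mulN1r -invfM -expr2.
by do !apply: CkM => //; apply: Ck_cst || apply: Dg.
Qed.

(** These functions contain [exp (- 1 / x)], extended by [0], and their span is
    stable under differentiation, so that all of them are smooth at once. *)
Definition flat j (x : R) : R := if 0 < x then x ^- j * expR (- x^-1) else 0.

Lemma flat_ge0 j x : 0 <= flat j x.
Proof.
rewrite /flat; case: ifP => // x0.
by rewrite mulr_ge0 ?expR_ge0 // invr_ge0 exprn_ge0 // ltW.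
Qed.

Lemma flat_gt0 x : 0 < x -> 0 < flat 0 x.
Proof. by move=> x0; rewrite /flat x0 expr0 invr1 mul1r expR_gt0. Qed.

Lemma flat_le0 j x : x <= 0 -> flat j x = 0.
Proof. by rewrite /flat leNgt => /negbTE ->. Qed.

Lemma flatS j x : flat j x = flat j.+1 x * x.
Proof.
rewrite /flat; case: ifP => [x0|]; last by rewrite mul0r.
have x0' : x != 0 by rewrite gt_eqF.
by rewrite mulrAC exprSr invfM divfK.
Qed.

(** The bound comes from [t ^ (j + 1) / (j + 1)! <= exp t] at [t = 1 / x]. *)
Lemma flat_bound j x : flat j x <= (j.+1)`!%:R * `|x|.
Proof.
rewrite /flat; case: ifP => [x0|]; last by rewrite mulr_ge0.
have xi0 : 0 < x^-1 by rewrite invr_gt0.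
rewrite gtr0_norm // expRN.
have : x^-1 ^+ j.+1 / (j.+1)`!%:R <= expR x^-1.
  by apply: le_trans (expR_ge1Dxn j (ltW xi0)); rewrite lerDr.
have f0 : 0 < (j.+1)`!%:R :> R by rewrite ltr0n fact_gt0.
rewrite ler_pdivrMr // => H.
rewrite ler_pdivrMr ?expR_gt0 // -exprVn.
rewrite -(ler_pM2l xi0) -exprS (le_trans H) //.
by rewrite [leLHS]mulrC [_ * x]mulrC -mulrA mulKf ?gt_eqF.
Qed.

(** At [0] the difference quotient of [flat j] is [flat j.+1], which tends to [0]
    by [flat_bound]. *)
Lemma flat_derive j (x : R) :
  is_derive x 1 (flat j) (flat j.+2 x - j%:R * flat j.+1 x).
Proof.
have [x0|x0|->] := ltgtP x 0.
- rewrite !flat_le0 ?(ltW x0) // mulr0 subr0.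
  apply: (@near_eq_is_derive R R^o R^o (cst 0) _ _ _ _ _ (is_derive_cst _ _ _)).
  near=> y; rewrite flat_le0 //; apply: ltW; near: y; exact: lt_nbhsl.
- apply: (@near_eq_is_derive R R R (fun y => y ^- j * expR (- y^-1))).
    by near=> y; rewrite /flat ifT //; near: y; exact: lt_nbhsr.
  have xn0 : x != 0 by rewrite gt_eqF.
  have xj0 : x ^+ j != 0 by rewrite expf_neq0.
  have Dj : is_derive x (1 : R) (fun y : R => y ^+ j) (j%:R * x ^+ j.-1).
    have := @is_deriveX R R id j x 1 1 (is_derive_id _ _).
    rewrite (_ : id ^+ j = fun y : R => y ^+ j); last first.
      by apply/funext => y; rewrite fctE.
    by rewrite [_ *: _]mulr1.
  have D1 := @is_deriveV R _ x _ 1 xj0 Dj.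
  have DV := @is_deriveV R id x _ 1 xn0 (is_derive_id _ _).
  have D2 := @is_deriveN R R R _ x 1 _ DV.
  have D3 := @is_derive1_comp R expR _ x _ _ (is_derive_expR _) D2.
  apply: (@is_derive_eq R R R _ x 1 _ _ (@is_deriveM R R _ _ x 1 _ _ D1 D3)).
  rewrite /flat x0 /GRing.scale /=.
  clear -xn0 xj0; case: j xj0 => [|j] xj0; rewrite ?mulr0n /=.
    by rewrite !exprS !expr0; field.
  have xj0' : x ^+ j != 0 by rewrite expf_neq0.
  by rewrite !exprS -/(x ^+ j) -mulr_natr; field; rewrite xj0'.
rewrite !flat_le0 // mulr0 subr0; apply/is_derive1_caratheodory.
exists (flat j.+1); split; last by rewrite flat_le0.
  by move=> y; rewrite [flat j 0]flat_le0 // !subr0 -flatS.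
rewrite /prop_for /continuous_at flat_le0 //.
apply: (@squeeze_cvgr _ _ _ _ (cst 0) (fun y => (j.+2)`!%:R * `|y|)).
- by near=> y; rewrite flat_ge0 flat_bound.
- exact: cvg_cst.
- rewrite -[X in _ --> X](mulr0 (j.+2)`!%:R) -[X in _ * X](@normr0 R R).
  by apply: cvgM; [exact: cvg_cst|apply: cvg_norm; exact: cvg_id].
Unshelve. all: end_near. Qed.

Lemma Ck_flat (V : normedModType R) j k (U : set V) (g : V -> R) : open U ->
  Ck k U g -> Ck k U (flat j \o g).
Proof.
move=> oU; elim: k j => [|k IH] j Cg.
  move=> x Ux; apply: continuous_comp; first exact: Cg.
  apply/differentiable_continuous/derivable1_diffP.
  by case: (flat_derive j (g x)).
have Cg' := CkS Cg; case: Cg => dg Dg.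
have dF x : U x -> _ := fun Ux => comp_scalar_derive (dg x Ux) (flat_derive j _).
split=> [x Ux|v]; first by case: (dF x Ux).
apply: (@Ck_eq R _ _ _ _
  ('D_v g * (flat j.+2 \o g + cst (- j%:R) * (flat j.+1 \o g)))) => //.
  by move=> x Ux; case: (dF x Ux) => _ /(_ v) ->; rewrite -mulNr.
apply: CkM => //; first exact: Dg.
apply: CkD => //; first exact: IH.
apply: CkM => //; [exact: Ck_cst|exact: IH].
Qed.

(** The quotient is a bump function of [t / e]: its denominator never vanishes, it
    is [0] for [`|t| >= e] and [1] for [`|t| <= e / 2]. *)
Definition clamp (e t : R) : R :=
  t * (flat 0 (1 - (t / e) ^+ 2) /
       (flat 0 (1 - (t / e) ^+ 2) + flat 0 ((t / e) ^+ 2 - 4^-1))).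

Lemma flat_sum_gt0 (s : R) : 0 < flat 0 (1 - s) + flat 0 (s - 4^-1).
Proof.
have [s1|s1] := ltP s 1.
  by rewrite ltr_pwDl ?flat_ge0 // flat_gt0 // subr_gt0.
rewrite ltr_wpDl ?flat_ge0 // flat_gt0 // subr_gt0 (lt_le_trans _ s1) //.
by rewrite invf_lt1 // ltr1n.
Qed.

Lemma clamp_lt e t : 0 < e -> `|clamp e t| < e.
Proof.
move=> e0; rewrite /clamp; set s := (t / e) ^+ 2.
have D0 := flat_sum_gt0 s.
have [te|te] := ltP `|t| e.
  apply: le_lt_trans te; rewrite normrM ler_piMr //.
  rewrite ger0_norm ?divr_ge0 ?flat_ge0 ?(ltW D0) //.
  by rewrite ler_pdivrMr // mul1r lerDl flat_ge0.
rewrite [flat 0 (1 - s)]flat_le0 ?mul0r ?mulr0 ?normr0 // subr_le0.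
rewrite /s -real_normK ?num_real // normrM normfV (gtr0_norm e0).
rewrite -[leLHS](expr1n _ 2) lerXn2r ?nnegrE ?(divr_ge0, ltW e0) //.
by rewrite ler_pdivlMr // mul1r.
Qed.

Lemma clamp_id e t : 0 < e -> `|t| < e / 2 -> clamp e t = t.
Proof.
move=> e0 te; rewrite /clamp; set s := (t / e) ^+ 2.
have D0 := flat_sum_gt0 s.
have s4 : s - 4^-1 <= 0.
  have -> : 4^-1 = 2^-1 ^+ 2 :> R by field.
  rewrite subr_le0 /s -real_normK ?num_real // normrM normfV (gtr0_norm e0).
  rewrite lerXn2r ?nnegrE ?invr_ge0 ?(divr_ge0, ltW e0) //.
  by rewrite ler_pdivrMr // mulrC ltW.
rewrite (flat_le0 _ s4) addr0 in D0 *.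
by rewrite divff ?mulr1 // gt_eqF.
Qed.

Lemma Ck_clamp (V : normedModType R) k (U : set V) (g : V -> R) e : open U ->
  Ck k U g -> Ck k U (fun x => clamp e (g x)).
Proof.
move=> oU Cg.
have Cs : Ck k U (fun x => (g x / e) ^+ 2).
  have Ce : Ck k U (g * cst e^-1) by apply: CkM => //; apply: Ck_cst.
  exact: (CkM oU Ce Ce).
have C1 : Ck k U (fun x => flat 0 (1 - (g x / e) ^+ 2)).
  apply: (@Ck_flat _ 0) => //.
  apply: (@Ck_eq R _ _ _ _ (cst 1 + cst (-1) * (fun x => (g x / e) ^+ 2))) => //.
    by move=> x _; rewrite -[in RHS]mulN1r.
  by do ?[apply: CkD|apply: CkM] => //; apply: Ck_cst.
have C2 : Ck k U (fun x => flat 0 ((g x / e) ^+ 2 - 4^-1)).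
  by apply: (@Ck_flat _ 0) => //; apply: CkD => //; apply: Ck_cst.
apply: CkM => //; apply: CkM => //; apply: Ck_inv => //; last exact: CkD.
by move=> x _; rewrite gt_eqF // flat_sum_gt0.
Qed.

End Calculus.

(** * Germs of plots *)

Section Germs.
Variable R : realType.
Implicit Types X Y : diffSpace R.

Definition edomI n (U V : edom R n) : edom R n :=
  EDom (openI (@edom_open _ _ U) (@edom_open _ _ V)).

(** Plots are maps on subtypes; germs of total maps avoid transport between the
    subtypes of nested open sets, and make smoothness a property that holds near
    a point. *)
Definition plot_at X n (f : 'rV[R]_n -> X) (x : 'rV[R]_n) : Prop :=
  exists U : edom R n, (U : set _) x /\ plot (fun u : U => f (val u)).

Lemma edom_nbhs n (U : edom R n) x : (U : set _) x -> nbhs x U.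
Proof. by move=> Ux; apply: open_nbhs_nbhs; split=> //; apply: edom_open. Qed.

Lemma near_at n (x : 'rV[R]_n) (Q : 'rV[R]_n -> Prop) :
  (\forall y \near x, Q y) -> Q x.
Proof. exact: nbhs_singleton. Qed.

Lemma near_all n (x : 'rV[R]_n) (Q : 'rV[R]_n -> Prop) :
  (forall y, Q y) -> \forall y \near x, Q y.
Proof. by move=> H; near=> y. Unshelve. all: end_near. Qed.

Lemma near_edom n (x : 'rV[R]_n) (Q : 'rV[R]_n -> Prop) :
  (\forall y \near x, Q y) ->
  exists2 V : edom R n, (V : set _) x & forall y, (V : set _) y -> Q y.
Proof.
by rewrite /prop_near1 nbhsE => -[V [oV Vx] VQ]; exists (EDom oV).
Qed.

Lemma plot_restr X n (U V : edom R n) (f : 'rV[R]_n -> X) : V `<=` U ->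
  plot (fun u : U => f (val u)) -> plot (fun v : V => f (val v)).
Proof.
move=> VU; apply: (plot_comp (f := subfun VU)); exists id.
by split=> // k; exact: Ck_id.
Qed.

Lemma plot_at_near X n (f : 'rV[R]_n -> X) x :
  plot_at f x -> \forall y \near x, plot_at f y.
Proof. by case=> U [/edom_nbhs Ux pf]; apply: filterS Ux => y Uy; exists U. Qed.

Lemma plot_at_eq X n (f g : 'rV[R]_n -> X) x :
  (\forall y \near x, f y = g y) -> plot_at f x -> plot_at g x.
Proof.
move=> /near_edom[W Wx fg] [U [Ux pf]].
exists (edomI U W); split=> //.
rewrite (_ : (fun _ => _) = fun u : edomI U W => f (val u)).
  by apply: plot_restr pf => y [].
by apply/funext => u; rewrite fg //; case: (set_valP u).
Qed.

Lemma plot_of_germs X n (U : edom R n) (p : U -> X) :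
  (forall u : U, exists2 f : 'rV[R]_n -> X,
     (forall v, f (val v) = p v) & plot_at f (val u)) -> plot p.
Proof.
move=> loc; apply: plot_local => u; have [f fp [V [Vu pf]]] := loc u.
have VU : edomI U V `<=` U by move=> y [].
exists (edomI U V), VU; split; first by split=> //; apply: set_valP.
rewrite (_ : _ \o _ = fun v : edomI U V => f (val v)).
  by apply: plot_restr pf => y [].
by apply/funext => v /=; rewrite -fp.
Qed.

Definition total_ext X n (U : edom R n) (x0 : X) (p : U -> X) (y : 'rV[R]_n) :=
  oapp p x0 (insub y).

Lemma total_extE X n (U : edom R n) (x0 : X) (p : U -> X) (u : U) :
  total_ext x0 p (val u) = p u.
Proof. by rewrite /total_ext valK. Qed.

Lemma total_ext_plot_at X n (U : edom R n) (x0 : X) (p : U -> X) (u : U) :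
  plot p -> plot_at (total_ext x0 p) (val u).
Proof.
move=> pp; exists U; split; first exact: set_valP.
rewrite (_ : (fun _ => _) = p) //.
by apply/funext => v; rewrite total_extE.
Qed.

Definition Cinf m n (h : 'rV[R]_m -> 'rV[R]_n) := forall k, Ck k setT h.

Lemma plot_at_precomp X m n (h : 'rV[R]_m -> 'rV[R]_n) (f : 'rV[R]_n -> X) x :
  Cinf h -> plot_at f (h x) -> plot_at (f \o h) x.
Proof.
move=> Ch [U [Ux pf]].
have ch : continuous h by move=> y; apply: (Ch 0).
have oV : open (h @^-1` U).
  by apply: open_comp => [y _|]; [exact: ch|exact: edom_open].
exists (EDom oV); split=> //.
have hP (v : EDom oV) : (U : set _) (h (val v)) by have := set_valP v.
pose hV (v : EDom oV) : U := SigSub (mem_set (hP v)).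
apply: (@plot_comp R X m n (EDom oV) U hV (fun u => f (val u))) => //.
by exists h; split=> // k; apply: Ck_sub (Ch k).
Qed.

Lemma plot_at_post X Y n (f : X -> Y) (g : 'rV[R]_n -> X) x :
  is_smooth f -> plot_at g x -> plot_at (f \o g) x.
Proof. by move=> sf [U [Ux pg]]; exists U; split=> //; apply: sf pg. Qed.

Lemma plot_at_pair X Y n (f : 'rV[R]_n -> X) (g : 'rV[R]_n -> Y) x :
  plot_at f x -> plot_at g x ->
  @plot_at (dprod X Y) n (fun y => (f y, g y)) x.
Proof.
move=> [U [Ux pf]] [V [Vx pg]]; exists (edomI U V); split=> //.
by split; [apply: plot_restr pf|apply: plot_restr pg] => y [].
Qed.

Lemma plot_at_cst X n (c : X) (x : 'rV[R]_n) : plot_at (fun=> c) x.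
Proof.
by exists (EDom openT); split=> //; apply: plot_cst.
Qed.

Lemma Cinf_plot_at m n (h : 'rV[R]_m -> 'rV[R]_n) x :
  Cinf h -> @plot_at (euclid R n) m h x.
Proof.
by move=> Ch; exists (EDom openT); split=> //; exists h; split.
Qed.

End Germs.

(** * Principal bundles through local lifts and differences *)

Section Torsors.
Variables (R : realType) (G : diffGroup R).

Lemma plot_at_act (P : dgSpace G) n (e : 'rV[R]_n -> P) (g : 'rV[R]_n -> G) x :
  plot_at e x -> plot_at g x -> plot_at (fun y => dgs_act (e y) (g y)) x.
Proof.
move=> pe pg.
exact: (plot_at_post (@dgs_act_smooth _ _ P) (plot_at_pair pe pg)).
Qed.

Lemma plot_at_mul n (f g : 'rV[R]_n -> G) x :
  plot_at f x -> plot_at g x -> plot_at (fun y => dg_mul (f y) (g y)) x.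
Proof.
move=> pf pg; exact: (plot_at_post (@dg_mul_smooth _ G) (plot_at_pair pf pg)).
Qed.

Lemma plot_at_inv n (g : 'rV[R]_n -> G) x :
  plot_at g x -> plot_at (fun y => dg_inv (g y)) x.
Proof. exact: (plot_at_post (@dg_inv_smooth _ G)). Qed.

Lemma dg_mulKg (a b : G) : dg_mul a (dg_mul (dg_inv a) b) = b.
Proof. by rewrite dg_mulA dg_mulgV dg_mul1g. Qed.

Lemma dg_mulgI (a b c : G) : dg_mul a b = dg_mul a c -> b = c.
Proof.
move=> /(congr1 (dg_mul (dg_inv a))).
by rewrite !dg_mulA dg_mulVg !dg_mul1g.
Qed.

Variables (X : diffSpace R) (P : dgOver G X).
Local Notation pr := (dgo_proj P).

Definition free_action := forall (e : P) g h, e ** g = e ** h -> g = h.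

Definition local_lifts := forall n (q : 'rV[R]_n -> X) x, plot_at q x ->
  exists2 s : 'rV[R]_n -> P, plot_at s x & \forall y \near x, pr (s y) = q y.

(** A total function [dv] is used for the difference of two points, with arbitrary
    values on pairs that do not lie in the same fibre. *)
Definition division (dv : P -> P -> G) :=
  (forall e e', pr e = pr e' -> e ** dv e e' = e') /\
  (forall n (e e' : 'rV[R]_n -> P) x, plot_at e x -> plot_at e' x ->
    (\forall y \near x, pr (e y) = pr (e' y)) ->
    plot_at (fun y => dv (e y) (e' y)) x).

Definition smooth_torsor :=
  [/\ free_action, local_lifts & exists dv, division dv].

Lemma pointwise_division : (forall e e', pr e = pr e' -> exists g, e ** g = e') ->
  exists dv, forall e e', pr e = pr e' -> e ** dv e e' = e'.
Proof.
move=> tr.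
have /choice[dv dvE] : forall ee : P * P,
    exists g, pr ee.1 = pr ee.2 -> ee.1 ** g = ee.2.
  move=> [e e']; have [/tr[g eg]|ne] := pselect (pr e = pr e').
    by exists g.
  by exists (dg_one G).
by exists (fun e e' => dv (e, e')) => e e' /(dvE (e, e')).
Qed.

(** A local trivialization [f] gives the local section [s] that corresponds to the
    unit of [G], and the second component of [f] is the coordinate along [s]. *)
Lemma local_trivialization n (q : 'rV[R]_n -> X) x :
  diff_principal P -> plot_at q x ->
  exists s : 'rV[R]_n -> P,
    [/\ plot_at s x, \forall y \near x, pr (s y) = q y,
        forall g h, s x ** g = s x ** h -> g = h
      & forall e : 'rV[R]_n -> P, plot_at e x ->
          (\forall y \near x, pr (e y) = q y) ->
          exists2 k : 'rV[R]_n -> G, plot_at k x &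
            \forall y \near x, s y ** k y = e y].
Proof.
move=> HP [U [Ux pq]].
have [I [A [oA cA isoA]]] := HP n U _ pq.
pose u0 : U := SigSub (mem_set Ux).
have [i _ Aiu0] : (\bigcup_i A i) u0 by rewrite cA.
have {isoA} [f [f' [fK f'K fact fproj]]] := isoA i.
have oV : open (val @` (A i)).
  by apply: (oA i n U id); exists id; split=> // k; exact: Ck_id.
set V := EDom oV.
have /choice[c cE] : forall v : V, exists a : dsub (A i), val (val a) = val v.
  by move=> v; have [a Aa av] := set_valP v; exists (SigSub (mem_set Aa)).
have pc : plot (c : V -> dsub (A i)).
  by exists id; split=> [k|v]; [exact: Ck_id|rewrite /= cE].
pose F v := f' (c v, dg_one G).
have F1 v : (val (val (F v))).1 = val (c v).
  by have := fproj (F v); rewrite f'K /= => ->.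
pose s0 v : P := (val (val (F v))).2.
have ps0 : plot s0.
  have : plot (F : V -> dgo_restr (dgo_pull (plot_dMap pq) P) (A i)).
    by apply: (dMapP f'); split=> //; apply: plot_cst.
  by case.
have Vx : (V : set _) x by exists u0.
pose v0 : V := SigSub (mem_set Vx).
(* The default value only serves to define [s] outside [V]. *)
pose s := total_ext (s0 v0) s0.
have sE (v : V) : s (val v) = s0 v by rewrite /s total_extE.
have prs (v : V) : pr (s (val v)) = q (val v).
  by rewrite sE -cE -F1; have := set_valP (val (F v)); rewrite /= => ->.
have ps : plot_at s x by apply: (@total_ext_plot_at _ _ _ V (s0 v0) s0 v0).
have nV := @edom_nbhs _ _ V _ Vx.
exists s; split => //.
- by apply: filterS nV => y Vy; apply: (prs (SigSub (mem_set Vy))).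
- move=> g h; rewrite -[x]/(val v0) sE /s0 => gh.
  have /(congr1 f) : dgs_act (F v0) g = dgs_act (F v0) h.
    by apply/val_inj/val_inj; rewrite /= gh.
  by rewrite !fact f'K /= /triv_act /= !dg_mul1g => -[].
move=> e pe peq.
have : \forall y \near x, [/\ (V : set _) y, pr (e y) = q y & plot_at e y].
  by near=> y; split; near: y => //; exact: plot_at_near.
move=> /near_edom[E Ex EP].
have toV (w : E) : (V : set _) (val w) by case: (EP _ (set_valP w)).
pose cw (w : E) := c (SigSub (mem_set (toV w))).
have mkP (w : E) : plot_dMap pq (val (cw w)) = pr (e (val w)).
  by rewrite /= cE /=; case: (EP _ (set_valP w)).
pose mk0 (w : E) : pull_tot (plot_dMap pq) P :=
  SigSub (mem_set (mkP w :
    [set z | plot_dMap pq z.1 = pr z.2] (val (cw w), e (val w)))).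
have mkA (w : E) : (dgo_proj (dgo_pull (plot_dMap pq) P) @^-1` A i) (mk0 w).
  by rewrite /preimage /=; apply: set_valP (cw w).
pose mk (w : E) : dgo_restr (dgo_pull (plot_dMap pq) P) (A i) :=
  SigSub (mem_set (mkA w)).
have pmk : plot mk.
  split=> /=; first by exists id; split=> [k|w]; [exact: Ck_id|rewrite /= cE].
  apply: plot_of_germs => w; exists e => //.
  by case: (EP _ (set_valP w)).
pose k0 (w : E) : G := (f (mk w)).2.
have pk0 : plot k0 by have [] := dMapP f pmk.
exists (total_ext (dg_one G) k0).
  exact: (@total_ext_plot_at _ _ _ E _ _ (SigSub (mem_set Ex))).
have : nbhs x E by apply: edom_nbhs.
apply: filterS => y Wy; pose w : E := SigSub (mem_set Wy).
rewrite -[y]/(val w) total_extE.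
rewrite -[val w]/(val (SigSub (mem_set (toV w)) : V)) sE /s0.
set v : V := SigSub _.
suff /(congr1 f') : f (dgs_act (F v) (k0 w)) = f (mk w).
  by rewrite !fK => /(congr1 (fun z => (val (val z)).2)).
rewrite fact f'K /= /triv_act /= dg_mul1g /k0.
rewrite [RHS]surjective_pairing; congr pair.
by have := fproj (mk w); rewrite /= => ->; apply/val_inj.
Unshelve. all: end_near. Qed.

Lemma smooth_torsor_of_principal : diff_principal P -> smooth_torsor.
Proof.
move=> HP.
(* Over a single point: constant germs on [R^0]. *)
have pt e := local_trivialization HP (plot_at_cst (pr e) (0 : 'rV[R]_0)).
have fr : free_action.
  move=> e g h egh; have [s [_ _ fs ts]] := pt e.
  have [] := ts (fun=> e) (plot_at_cst _ _); first exact: near_all.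
  move=> k _ /near_at sk; move: egh; rewrite -sk -!dgs_actM.
  by move=> /fs /dg_mulgI.
have tr e e' : pr e = pr e' -> exists g, e ** g = e'.
  move=> ee'; have [s [_ _ fs ts]] := pt e.
  have [] := ts (fun=> e) (plot_at_cst _ _); first exact: near_all.
  move=> k _ /near_at sk.
  have [] := ts (fun=> e') (plot_at_cst _ _); first exact: near_all.
  move=> k' _ /near_at sk'.
  exists (dg_mul (dg_inv (k 0)) (k' 0)).
  by rewrite -{1}sk -dgs_actM dg_mulKg.
split=> //.
  by move=> n q x /(local_trivialization HP)[s [ps qs _ _]]; exists s.
have [dv dvE] := pointwise_division tr.
exists dv; split=> //.
move=> n e e' x pe pe' ee'.
have [s [_ _ _ ts]] := local_trivialization HP (plot_at_post (dMapP pr) pe).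
have [] := ts e pe; first exact: near_all.
move=> k pk sk.
have [] := ts e' pe'; first by apply: filterS ee' => y /esym.
move=> k' pk' sk'.
apply: plot_at_eq (plot_at_mul (plot_at_inv pk) pk').
near=> y; apply: (fr (e y)).
rewrite dvE; last by near: y.
have <- : s y ** k y = e y by near: y.
have <- : s y ** k' y = e' y by near: y.
by rewrite -dgs_actM dg_mulKg.
Unshelve. all: end_near. Qed.

End Torsors.

Section TorsorPrincipal.
Variables (R : realType) (G : diffGroup R) (X : diffSpace R) (P : dgOver G X).
Local Notation pr := (dgo_proj P).

Lemma division_plot (dv : P -> P -> G) n (U : edom R n) (e e' : U -> P) :
  division dv -> plot e -> plot e' -> (forall u, pr (e u) = pr (e' u)) ->
  plot (fun u => dv (e u) (e' u)).
Proof.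
move=> dvP pe pe' ee'; apply: plot_of_germs => u.
exists (fun y => dv (total_ext (e u) e y) (total_ext (e' u) e' y)).
  by move=> v; rewrite !total_extE.
apply: dvP.2; [exact: total_ext_plot_at..|].
apply: filterS (edom_nbhs (set_valP u)) => y Uy.
by rewrite -[y]/(val (SigSub (mem_set Uy) : U)) !total_extE.
Qed.

(** The index type of the trivializing cover: all local lifts of [p]. *)
Definition lifting_domain n (U : edom R n) (p : U -> X) :=
  {Vs : edom R n * ('rV[R]_n -> P) |
    [/\ Vs.1 `<=` U, plot (fun v : Vs.1 => Vs.2 (val v))
      & forall u : U, (Vs.1 : set _) (val u) -> pr (Vs.2 (val u)) = p u]}.

Lemma principal_of_smooth_torsor : smooth_torsor P -> diff_principal P.
Proof.
move=> [fr ll [dv dvP]] n U p pp.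
pose DU := @dsub R (euclid R n) U.
pose A (i : lifting_domain p) : set DU := val @^-1` (sval i).1.
exists (lifting_domain p), A; split.
- move=> i m W r [g [Cg rg]].
  rewrite openE => _ [w Aw <-].
  have Ww : (W : set _) (val w) by apply: set_valP.
  have nV : nbhs (g (val w)) (sval i).1.
    by rewrite -rg; apply: edom_nbhs.
  have nW : nbhs (val w) W by apply: edom_nbhs.
  have : nbhs (val w) (g @^-1` (sval i).1) by apply: (Cg 0%N _ Ww).
  move=> ng; apply: filterS2 nW ng => y Wy gy.
  by exists (SigSub (mem_set Wy)) => //=; rewrite /A /preimage /= rg.
- apply/seteqP; split=> // u _.
  have [s ps prs] := ll n _ _ (total_ext_plot_at (p u) u pp).
  have : \forall y \near val u,
      [/\ (U : set _) y, plot_at s y & pr (s y) = total_ext (p u) p y].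
    near=> y; split; near: y => //; last exact: plot_at_near.
    by apply: edom_nbhs; apply: set_valP.
  move=> /near_edom[V Vu HV].
  have Vs : [/\ V `<=` U, plot (fun v : V => s (val v))
      & forall u : U, (V : set _) (val u) -> pr (s (val u)) = p u].
    split.
    + by move=> y /HV[].
    + apply: plot_of_germs => v; exists s => //.
      by case: (HV _ (set_valP v)).
    + by move=> v /HV[_ _ ->]; rewrite total_extE.
  by exists (exist _ (V, s) Vs).
move=> [[V s] [/= VU ps prs]].
set i := exist _ _ _.
pose D := dgo_restr (dgo_pull (plot_dMap pp) P) (A i).
pose w (z : D) : (DU * P)%type := val (val z : pull_tot (plot_dMap pp) P).
have prz (z : D) : pr (s (val (w z).1)) = pr (w z).2.
  have /= <- := set_valP (val z : pull_tot (plot_dMap pp) P).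
  exact: (prs _ (set_valP z)).
have toV m (W : edom R m) (c : W -> dsub (A i)) : plot c ->
    plot (fun w => s (val (val (c w)))).
  move=> pc.
  have cV v : (V : set _) (val (val (c v))) by exact: (set_valP (c v)).
  exact: (@plot_comp R P m n W V (fun v => SigSub (mem_set (cV v))) _ pc ps).
pose f0 (z : D) : dgo_triv G (dsub (A i)) :=
  (dgo_proj D z, dv (s (val (w z).1)) (w z).2).
have sf0 : is_smooth f0.
  move=> m W c pc; split=> /=; first exact: (dMapP (dgo_proj D)).
  apply: (division_plot dvP) => [||v]; last exact: prz.
    apply: (toV m W (fun v => dgo_proj D (c v))).
    exact: (dMapP (dgo_proj D)).
  by case: pc.
have gP (z : dprod (dsub (A i)) G) :
    plot_dMap pp (val z.1) = pr (s (val (val z.1)) ** z.2).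
  by rewrite dgo_projM prs //; apply: (set_valP z.1).
pose g0 (z : dgo_triv G (dsub (A i))) : dgo_pull (plot_dMap pp) P :=
  SigSub (mem_set (gP z : [set y | plot_dMap pp y.1 = pr y.2]
    (val z.1, s (val (val z.1)) ** z.2))).
have gA z : (dgo_proj (dgo_pull (plot_dMap pp) P) @^-1` A i) (g0 z).
  exact: (set_valP z.1).
pose g1 z : D := SigSub (mem_set (gA z)).
have sg1 : is_smooth g1.
  move=> m W c [pc1 pc2]; split=> //=.
  exact: (@dgs_act_smooth R G P m W
    (fun v => (s (val (val (c v).1)), (c v).2)) (conj (toV _ _ _ pc1) pc2)).
exists (DMap sf0), (DMap sg1); split.
- move=> z; apply/val_inj/val_inj; rewrite /= dvP.1; last exact: prz.
  by rewrite -surjective_pairing.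
- move=> [a g]; rewrite /= /f0; congr pair; first exact/val_inj.
  apply: (fr (s (val (val a)))); rewrite dvP.1 //=.
  by rewrite dgo_projM.
- move=> z g; rewrite /= /f0 /triv_act /=; congr pair; first exact/val_inj.
  apply: (fr (s (val (w z).1))); rewrite dgs_actM !dvP.1 //.
  by rewrite dgo_projM; apply: prz.
- by [].
Unshelve. all: end_near. Qed.

End TorsorPrincipal.

(** * Global lifts over Euclidean spaces *)

Section Chaining.
Variable R : realType.

(** Compactness of intervals in the form of Cousin's lemma: around the supremum of
    the [v] in [[u, w]] with [Q u v], the relation [Q] extends past it, so that it
    is [w] and is attained. *)
Lemma interval_chaining (Q : R -> R -> Prop) :
  (forall u v w, u <= v <= w -> Q u v -> Q v w -> Q u w) ->
  (forall t, exists2 d, 0 < d &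
     forall u w, `|u - t| < d -> `|w - t| < d -> Q u w) ->
  forall u w, u <= w -> Q u w.
Proof.
move=> Qtrans Qloc u w uw.
pose T := [set v | u <= v <= w /\ Q u v].
have Tu : T u.
  rewrite /T /= lexx uw; split=> //.
  by have [d d0] := Qloc u; apply; rewrite subrr normr0.
have Tw : ubound T w by move=> v [/andP[]].
have sT : has_sup T by split; [exists u|exists w].
have us : u <= sup T by apply: (ub_le_sup sT.2 Tu).
have sw : sup T <= w by apply: (ge_sup sT.1 Tw).
have [d d0 dQ] := Qloc (sup T).
have [v Tv sv] := sup_adherent d0 sT.
have vs : v <= sup T by apply: (ub_le_sup sT.2 Tv).
have Qx x : sup T <= x -> x < sup T + d -> Q u x.
  move=> sx xd; apply: (Qtrans _ v); [|by case: Tv|].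
    by case: Tv => /andP[-> _] _; exact: le_trans sx.
  by apply: dQ; rewrite ltr_norml; lra.
have [wd|wd] := ltP w (sup T + d); first exact: Qx.
have : T (sup T + d / 2).
  by split; [lra|apply: Qx; lra].
by move=> /(ub_le_sup sT.2); lra.
Qed.

End Chaining.

Section CoordinateMaps.
Variable R : realType.

Lemma Cinf_row m n (h : 'I_n -> 'rV[R]_m -> R) :
  (forall j k, Ck k setT (h j)) -> Cinf (fun y => \row_j h j y).
Proof.
move=> Ch k; apply/Ck_coordP => [|j]; first exact: openT.
by under eq_fun do rewrite mxE; apply: Ch.
Qed.

Lemma Ck_coord n (i : 'I_n) k : Ck k setT (fun y : 'rV[R]_n => y 0 i).
Proof. exact: (Ck_coordP k id openT).1 (@Ck_id _ _ _ _) i. Qed.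

Definition clamp_coord n (i : 'I_n) (m e : R) (y : 'rV[R]_n) : 'rV[R]_n :=
  \row_j (if j == i then m + clamp e (y 0 i - m) else y 0 j).

Lemma Ck_clamp_around n k (i : 'I_n) (m e : R) :
  Ck k setT (fun y : 'rV[R]_n => m + clamp e (y 0 i - m)).
Proof.
apply: (CkD (f := cst m)) => //; first exact: openT; first exact: Ck_cst.
apply: Ck_clamp; first exact: openT.
apply: (CkD (g := cst (- m))); [exact: openT|exact: Ck_coord|exact: Ck_cst].
Qed.

Lemma Cinf_clamp_coord n (i : 'I_n) (m e : R) : Cinf (clamp_coord i m e).
Proof.
apply: Cinf_row => j k; case: (j == i); last exact: Ck_coord.
exact: Ck_clamp_around.
Qed.

Definition clamp_all n (c : 'rV[R]_n) (e : R) (y : 'rV[R]_n) : 'rV[R]_n :=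
  \row_j (c 0 j + clamp e (y 0 j - c 0 j)).

Lemma Cinf_clamp_all n (c : 'rV[R]_n) (e : R) : Cinf (clamp_all c e).
Proof. by apply: Cinf_row => j k; exact: Ck_clamp_around. Qed.

(** The margin [e] is separate from the end points because boxes are cut at common
    faces, while the lifts are defined on open neighborhoods. *)
Definition box n (a b : 'I_n -> R) (e : R) : set 'rV[R]_n :=
  [set y | forall j, a j - e < y 0 j < b j + e].

Lemma near_coord n (j : 'I_n) (y : 'rV[R]_n) (Q : R -> Prop) :
  (\forall t \near y 0 j, Q t) -> \forall z \near y, Q ((z : 'rV[R]_n) 0 j).
Proof. by move=> H; apply: (@coord_continuous R 1 n 0 j y Q). Qed.

Lemma open_box n (a b : 'I_n -> R) e : open (box a b e).
Proof.
rewrite openE => y By.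
pose f j := [set z : 'rV[R]_n | a j - e < z 0 j < b j + e].
apply: (@filter_forall _ _ f (nbhs y) _) => j.
have [ay yb] := andP (By j).
apply: (@near_coord n j y (fun t => a j - e < t < b j + e)).
by near=> t; apply/andP; split; near: t; [exact: lt_nbhsr|exact: lt_nbhsl].
Unshelve. all: end_near. Qed.

End CoordinateMaps.

Section Lifts.
Variables (R : realType) (G : diffGroup R) (X : diffSpace R) (P : dgOver G X).
Local Notation pr := (dgo_proj P).
Variable dv : P -> P -> G.
Hypothesis ll : local_lifts P.
Hypothesis dvP : division dv.
Variables (n : nat) (q : 'rV[R]_n -> X).
Hypothesis pq : forall x, plot_at q x.
Implicit Types a b : 'I_n -> R.

Definition lift_over (A : set 'rV[R]_n) (s : 'rV[R]_n -> P) :=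
  forall x, A x -> plot_at s x /\ pr (s x) = q x.

(** Where [r y = y], this is [s1 y], and elsewhere it is [s2 y] moved by the
    difference between [s2] and [s1] at [r y]; [s1] is only evaluated on the image
    of [r]. *)
Definition adjust (r : 'rV[R]_n -> 'rV[R]_n) (s1 s2 : 'rV[R]_n -> P) y :=
  s2 y ** dv (s2 (r y)) (s1 (r y)).

Lemma adjust_lift (A1 A2 : set 'rV[R]_n) r s1 s2 : open A1 -> open A2 ->
  Cinf r -> (forall y, A2 y -> A1 (r y) /\ A2 (r y)) ->
  lift_over A1 s1 -> lift_over A2 s2 -> lift_over A2 (adjust r s1 s2).
Proof.
move=> oA1 oA2 Cr rA l1 l2 y A2y; have [ps2 prs2] := l2 y A2y.
split; last by rewrite /adjust dgo_projM.
apply: plot_at_act => //; have [A1r A2r] := rA y A2y.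
apply: (plot_at_precomp (f := fun z => dv (s2 z) (s1 z)) Cr).
apply: dvP.2; [by case: (l2 _ A2r)|by case: (l1 _ A1r)|].
have n1 : nbhs (r y) A1 by apply: open_nbhs_nbhs.
have n2 : nbhs (r y) A2 by apply: open_nbhs_nbhs.
by near=> z; rewrite (l2 z _).2 1?(l1 z _).2 //; near: z.
Unshelve. all: end_near. Qed.

Lemma adjustE (A1 A2 : set 'rV[R]_n) r s1 s2 y : lift_over A1 s1 ->
  lift_over A2 s2 -> A1 y -> A2 y -> r y = y -> adjust r s1 s2 y = s1 y.
Proof.
move=> l1 l2 A1y A2y ry; rewrite /adjust ry; apply: dvP.1.
by rewrite (l2 _ A2y).2 (l1 _ A1y).2.
Qed.

Lemma lift_overS (A B : set 'rV[R]_n) s :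
  A `<=` B -> lift_over B s -> lift_over A s.
Proof. by move=> AB lB x /AB; apply: lB. Qed.

Definition liftable (a b : 'I_n -> R) :=
  exists2 e, 0 < e & exists s, lift_over (box a b e) s.

Definition upd (a : 'I_n -> R) i t j := if j == i then t else a j.

Lemma updK a i t t' : upd (upd a i t) i t' = upd a i t'.
Proof. by apply/funext => j; rewrite /upd; case: eqP. Qed.

Lemma upd_id a i : upd a i (a i) = a.
Proof. by apply/funext => j; rewrite /upd; case: eqP => // ->. Qed.

Lemma boxS a b e e' : e <= e' -> box a b e `<=` box a b e'.
Proof. by move=> ee' y By j; have := By j; lra. Qed.

(** The two boxes share the face where the coordinate [i] is [m].  The lift over
    the second one is adjusted along the map that clamps this coordinate to the
    overlap, and then agrees with the first lift near the face. *)
Lemma liftable_glue a b i m : a i <= m <= b i ->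
  liftable a (upd b i m) -> liftable (upd a i m) b -> liftable a b.
Proof.
move=> amb [e1 e10 [s1 l1]] [e2 e20 [s2 l2]].
pose e := Num.min e1 e2.
have e0 : 0 < e by rewrite lt_min e10.
have ee1 : e <= e1 by rewrite ge_min lexx.
have ee2 : e <= e2 by rewrite ge_min lexx orbT.
have {}l1 := lift_overS (boxS ee1) l1.
have {}l2 := lift_overS (boxS ee2) l2.
set A1 := box _ _ _ in l1; set A2 := box _ _ _ in l2.
pose r := clamp_coord i m e.
have rA y : A2 y -> A1 (r y) /\ A2 (r y).
  move=> A2y; have := clamp_lt (y 0 i - m) e0; rewrite ltr_norml => c.
  by split=> j; have := A2y j; rewrite /r mxE /upd; case: eqP => // ->; lra.
have l3 : lift_over A2 (adjust r s1 s2).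
  apply: adjust_lift l1 l2 => //; [exact: open_box..|].
  exact: Cinf_clamp_coord.
have rid (y : 'rV[R]_n) : m - e / 2 < y 0 i < m + e / 2 -> r y = y.
  move=> ym; apply/rowP => j; rewrite mxE; case: eqP => // ->.
  by rewrite clamp_id // ?ltr_norml; [rewrite addrC subrK|lra].
pose s (y : 'rV[R]_n) := if y 0 i <= m then s1 y else adjust r s1 s2 y.
exists e => //; exists s => y By.
have nB : nbhs y (box a b e).
  by apply: open_nbhs_nbhs; split=> //; exact: open_box.
have [ym|ym] := ltP (y 0 i) (m + e / 2).
- have A1y : A1 y.
    by move=> j; have := By j; rewrite /upd; case: eqP => // ->; lra.
  suff sE : \forall z \near y, s1 z = s z.
    rewrite -(near_at sE); have [ps1 prs1] := l1 y A1y; split=> //.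
    exact: plot_at_eq ps1.
  have nm : \forall z \near y, (z : 'rV[R]_n) 0 i < m + e / 2.
    by apply: (near_coord (Q := fun t => t < _)); exact: lt_nbhsl.
  near=> z; rewrite /s; case: ifP => // /negbT; rewrite -ltNge => mz.
  have zm : z 0 i < m + e / 2 by near: z.
  have Bz : box a b e z by near: z.
  apply/esym; apply: (adjustE l1 l2).
  + by move=> j; have := Bz j; rewrite /upd; case: eqP => // ->; lra.
  + by move=> j; have := Bz j; rewrite /upd; case: eqP => // ->; lra.
  + by apply: rid; lra.
have A2y : A2 y.
  by move=> j; have := By j; rewrite /upd; case: eqP => // ->; lra.
suff sE : \forall z \near y, adjust r s1 s2 z = s z.
  rewrite -(near_at sE); have [ps2 prs2] := l3 y A2y; split=> //.
  exact: plot_at_eq ps2.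
have nm : \forall z \near y, m < (z : 'rV[R]_n) 0 i.
  by apply: (near_coord (Q := fun t => m < t)); apply: lt_nbhsr; lra.
by near=> z; rewrite /s leNgt ifF //; apply/negbF; near: z.
Unshelve. all: end_near. Qed.

Lemma liftable_point a : liftable a a.
Proof.
pose x : 'rV[R]_n := \row_j a j.
have [s ps prs] := ll (pq x).
have : \forall y \near x, plot_at s y /\ pr (s y) = q y.
  by near=> y; split; near: y => //; exact: plot_at_near.
move=> /nbhs_ballP[e /= e0 eb]; exists e => //; exists s => y By; apply: eb.
split=> // i j; rewrite (ord1 i) mxE.
have := By j; rewrite /ball /= ltr_norml; lra.
Unshelve. all: end_near. Qed.

(** Induction on the number of coordinates in which the box is not reduced to a
    point: for fixed other coordinates, intervals in the next one are chained. *)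
Lemma liftable_box a b : (forall j, a j <= b j) -> liftable a b.
Proof.
suff H k : (forall j : 'I_n, (k <= j)%N -> a j = b j) ->
    (forall j, a j <= b j) -> liftable a b.
  by apply: (H n) => j; rewrite leqNgt ltn_ord.
elim: k a b => [|k IH] a b ab leab.
  by rewrite (_ : a = b); [exact: liftable_point|apply/funext => j; exact: ab].
have [kn|nk] := ltnP k n; last first.
  apply: IH => // j kj; apply: ab.
  by have := leq_trans nk kj; rewrite leqNgt ltn_ord.
pose i := Ordinal kn.
rewrite -(upd_id a i) -(upd_id b i).
apply: (@interval_chaining R (fun u w => liftable (upd a i u) (upd b i w))) => //.
  move=> u v w uvw uv vw; apply: (@liftable_glue _ _ i v); rewrite ?updK //.
  by rewrite /upd eqxx.
move=> t; have [||e e0 [s ls]] := IH (upd a i t) (upd b i t).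
- move=> j kj; rewrite /upd; case: eqVneq => // ji; apply: ab.
  by rewrite ltn_neqAle kj andbT eq_sym.
- by move=> j; rewrite /upd; case: eqP.
exists (e / 2); first by rewrite divr_gt0.
move=> u w ut wt; exists (e / 2); first by rewrite divr_gt0.
exists s; apply: lift_overS ls => y By j; have := By j.
by move: ut wt; rewrite /upd !ltr_norml; case: eqP => _; lra.
Qed.

(** The side doubles at each step because clamping to a cube fixes the points of
    the concentric cube of half its side. *)
Definition cube N : set 'rV[R]_n := box (fun=> - 2 ^+ N) (fun=> 2 ^+ N) 0.

Lemma cubeP N y : cube N y <-> forall j, `|y 0 j| < 2 ^+ N.
Proof.
by split=> H j; have := H j; rewrite ltr_norml subr0 addr0.
Qed.

Lemma cube_exhaust y : exists N, cube N y.
Proof.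
have : forall j : 'I_n, exists N, `|y 0 j| < 2 ^+ N.
  move=> j; exists (Num.truncn `|y 0 j|).+1.
  apply: lt_le_trans (truncnS_gt _) _; rewrite -natrX ler_nat.
  exact/ltnW/ltn_expl.
move=> /choice[f fP]; exists (\max_j f j); apply/cubeP => j.
by apply: lt_le_trans (fP j) _; rewrite ler_weXn2l ?ler1n // leq_bigmax.
Qed.

Lemma cube_mono M N : (M <= N)%N -> cube M `<=` cube N.
Proof.
move=> MN y /cubeP H; apply/cubeP => j.
by apply: lt_le_trans (H j) _; rewrite ler_weXn2l ?ler1n.
Qed.

(** The lift [t N] over [cube N] is constructed so that [t N.+2] agrees with
    [t N.+1] on [cube N]; the lifts [t N.+1] with [N] large therefore agree near
    every point. *)
Lemma global_lift : exists s, forall x, plot_at s x /\ pr (s x) = q x.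
Proof.
have /choice[s0 ls0] : forall N, exists s, lift_over (cube N) s.
  move=> N.
  have [|e e0 [s ls]] := @liftable_box (fun=> - 2 ^+ N) (fun=> 2 ^+ N).
    by move=> j; have : 0 <= 2 ^+ N :> R by []; lra.
  by exists s; apply: lift_overS ls; apply: boxS; apply: ltW.
pose r N := clamp_all (0 : 'rV[R]_n) (2 ^+ N).
pose fix t N := if N is N'.+1 then adjust (r N') (t N') (s0 N'.+1) else s0 0%N.
have p0 N : 0 < 2 ^+ N :> R by [].
have rN N y : cube N (r N y).
  by apply/cubeP => j; rewrite mxE mxE add0r; apply: clamp_lt.
have oc N : open (cube N) by exact: open_box.
have lt N : lift_over (cube N) (t N).
  elim: N => [|N IH]; first exact: ls0.
  apply: adjust_lift IH (ls0 N.+1) => //; first exact: Cinf_clamp_all.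
  by move=> y _; split=> //; apply: (@cube_mono N).
have rid N y : cube N y -> r N.+1 y = y.
  move=> /cubeP Cy; apply/rowP => j; rewrite mxE mxE add0r subr0 clamp_id //.
  by rewrite exprSr mulfK.
have tE N y : cube N y -> t N.+2 y = t N.+1 y.
  move=> Cy; apply: (adjustE (lt N.+1) (ls0 N.+2)); last exact: rid.
    exact: (@cube_mono N).
  by apply: (@cube_mono N) => //; rewrite -addn2 leq_addr.
have tE' M N y : (M <= N)%N -> cube M y -> t N.+1 y = t M.+1 y.
  move=> MN Cy; rewrite -(subnK MN); elim: (N - M)%N => // k IH.
  by rewrite addSn tE //; apply: (cube_mono _ Cy); rewrite leq_addl.
have /choice[f fP] := cube_exhaust.
exists (fun y => t (f y).+1 y) => x.
have sE : \forall y \near x, t (f x).+1 y = t (f y).+1 y.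
  have : nbhs x (cube (f x)) by apply: open_nbhs_nbhs.
  apply: filterS => y Cy; have [ff|ff] := leqP (f x) (f y).
    by rewrite (tE' (f x)).
  by rewrite (tE' (f y)) // ltnW.
have [px prx] := lt (f x).+1 x (cube_mono (leqnSn _) (fP x)).
by split=> //; apply: plot_at_eq px.
Qed.

End Lifts.

(** * From Euclidean to affine test spaces *)

Section AffineSimplices.
Variables (R : realType) (G : diffGroup R) (X : diffSpace R) (P : dgOver G X).
Local Notation pr := (dgo_proj P).

Definition affine_lifting := forall n (c : dMap (affine R n) X),
  exists s : dMap (affine R n) P, dMap_comp pr s = c.

Definition affine_transitivity := forall n (e e' : dMap (affine R n) P),
  dMap_comp pr e = dMap_comp pr e' ->
  exists g : dMap (affine R n) G, forall x, e x ** g x = e' x.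

Definition affine_torsor :=
  [/\ free_action P, affine_lifting & affine_transitivity].

Lemma cst_is_smooth (Y Z : diffSpace R) (z : Z) : @is_smooth R Y Z (fun=> z).
Proof. by move=> n U p _; apply: plot_cst. Qed.

Definition dMap_cst (Y Z : diffSpace R) (z : Z) : dMap Y Z :=
  DMap (@cst_is_smooth Y Z z).

Definition to_affine n (y : 'rV[R]_n) : 'rV[R]_n.+1 :=
  \row_j (if unlift ord0 j is Some i then y 0 i else 1 - \sum_i y 0 i).

Lemma to_affineP n (y : 'rV[R]_n) : affine_set (to_affine y).
Proof.
rewrite /affine_set /= big_ord_recl mxE unlift_none.
rewrite [X in _ + X](eq_bigr (fun i => y 0 i)) => [|i _].
  by rewrite subrK.
by rewrite mxE liftK.
Qed.

Definition affine_param n (y : 'rV[R]_n) : affine R n :=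
  SigSub (mem_set (to_affineP y)).

Lemma Ck_sum_coord n k : Ck k setT (fun y : 'rV[R]_n => 1 - \sum_i y 0 i).
Proof.
have Cs : Ck k setT (\sum_i (fun y : 'rV[R]_n => y 0 i)).
  by apply: Ck_sum => [|i]; [exact: openT|exact: Ck_coord].
have Cc c : Ck k setT (cst c : 'rV[R]_n -> R) by exact: Ck_cst.
apply: Ck_eq (CkD openT (Cc 1) (CkM openT (Cc (-1)) Cs)); first exact: openT.
move=> y _; rewrite -[LHS]/(1 + -1 * (\sum_i (fun y : 'rV[R]_n => y 0 i)) y).
by rewrite mulN1r fct_sumE.
Qed.

Lemma affine_param_plot n (y : 'rV[R]_n) : plot_at (@affine_param n) y.
Proof.
exists (EDom openT); split=> //; exists (@to_affine n); split=> //.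
apply: Cinf_row => j k; case: (unlift ord0 j) => [i|]; first exact: Ck_coord.
exact: Ck_sum_coord.
Qed.

(** The inclusion of [A^n] in [R^(n + 1)] is a section of this map, so that lifts
    over [A^n] can be found by restricting lifts over [R^(n + 1)]. *)
Definition retract n (y : 'rV[R]_n.+1) : 'rV[R]_n.+1 :=
  \row_j (if unlift ord0 j is Some _ then y 0 j
          else y 0 j + (1 - \sum_i y 0 i)).

Lemma retractP n (y : 'rV[R]_n.+1) : affine_set (retract y).
Proof.
rewrite /affine_set /= big_ord_recl mxE unlift_none.
rewrite [X in _ + X](eq_bigr (fun i => y 0 (lift ord0 i))) => [|i _].
  by rewrite [X in _ - X]big_ord_recl; ring.
by rewrite mxE liftK.
Qed.

Definition affine_retract n (y : 'rV[R]_n.+1) : affine R n :=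
  SigSub (mem_set (retractP y)).

Lemma affine_retract_plot n (y : 'rV[R]_n.+1) : plot_at (@affine_retract n) y.
Proof.
exists (EDom openT); split=> //; exists (@retract n); split=> //.
apply: Cinf_row => j k; case: (unlift ord0 j) => [_|]; first exact: Ck_coord.
by apply: CkD; [exact: openT|exact: Ck_coord|exact: Ck_sum_coord].
Qed.

Lemma affine_retractK n (a : affine R n) : affine_retract (val a) = a.
Proof.
apply/val_inj/rowP => j; rewrite /= mxE.
case: (unlift ord0 j) => [_//|].
have -> : \sum_i (val a) 0 i = 1 by apply: (set_valP a).
by rewrite subrr addr0.
Qed.

Lemma smooth_of_germs (Y : diffSpace R) n (s : 'rV[R]_n -> Y) :
  (forall x, plot_at s x) -> @is_smooth R (euclid R n) Y s.
Proof.
move=> ps m U p pp.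
have pT : plot (fun x : EDom openT => s (val x)).
  by apply: plot_of_germs => x; exists s.
exact: (@plot_comp R Y m n U (EDom openT)
  (fun u => SigSub (mem_set (I : [set: 'rV[R]_n] (p u)))) _ pp pT).
Qed.

(** Lifts of [A^n -> X] are restrictions of lifts of its composite with the
    retraction of [R^(n + 1)] onto [A^n]. *)
Lemma affine_torsor_of_smooth : smooth_torsor P -> affine_torsor.
Proof.
move=> [fr ll [dv dvP]]; split=> //.
- move=> n c.
  have pc y := plot_at_post (dMapP c) (@affine_retract_plot n y).
  have [s sP] := global_lift ll dvP pc.
  have ss : @is_smooth R (affine R n) P (fun a => s (val a)).
    move=> m U p pp.
    exact: (smooth_of_germs (fun x => (sP x).1) (p := fun u => val (p u))).
  exists (DMap ss); apply: dMap_eq => a /=.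
  by rewrite (sP _).2 /= affine_retractK.
move=> n e e' ee'.
have pee' x : pr (e x) = pr (e' x) := congr1 (fun h : dMap _ _ => h x) ee'.
have sg : @is_smooth R (affine R n) G (fun x => dv (e x) (e' x)).
  move=> m U p pp.
  apply: (division_plot dvP (e := e \o p) (e' := e' \o p)) => //.
  - exact: dMapP.
  - exact: dMapP.
  - by move=> u; apply: pee'.
by exists (DMap sg) => x; apply: dvP.1.
Qed.

(** The chart [f] is the projection of [A^n] onto [R^n] followed by a smooth map
    into a small cube around [x] that is the identity near [x]. *)
Lemma affine_chart n (U : edom R n) (x : 'rV[R]_n) : (U : set _) x ->
  exists f : dMap (affine R n) (@dsub R (euclid R n) U),
    \forall y \near x, val (f (affine_param y)) = y.
Proof.
move=> /edom_nbhs/nbhs_ballP[e /= e0 eU].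
pose f0 (z : 'rV[R]_n.+1) : 'rV[R]_n :=
  clamp_all x e (\row_j z 0 (lift ord0 j)).
have f0U z : (U : set _) (f0 z).
  apply: eU; split=> // i j; rewrite (ord1 i) /f0 mxE.
  by rewrite /ball /= opprD addNKr normrN; apply: clamp_lt.
pose f (a : affine R n) : @dsub R (euclid R n) U :=
  SigSub (mem_set (f0U (val a))).
have Cf : Cinf f0.
  move=> k; apply: (Ck_comp openT openT) => //; last exact: Cinf_clamp_all.
  by apply: Cinf_row => j l; exact: Ck_coord.
have sf : is_smooth f.
  move=> m V p pp.
  by apply: (smooth_of_germs (Y := euclid R n) (s := f0)
    (fun z => Cinf_plot_at z Cf) (p := fun u => val (p u)) pp).
exists (DMap sf).
have e20 : 0 < e / 2 by rewrite divr_gt0.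
apply: filterS (nbhsx_ballx x (e / 2) e20) => y [_ xy].
apply/rowP => j; have := xy 0 j; rewrite /ball /= distrC => xyj.
rewrite /f0 mxE [X in clamp e (X - _)]mxE [X in clamp e (X - _)]mxE liftK.
by rewrite clamp_id // addrC subrK.
Qed.

(** Local lifts and differences over an open set are obtained on the affine space
    that covers it by [affine_chart]. *)
Lemma smooth_torsor_of_affine : affine_torsor -> smooth_torsor P.
Proof.
move=> [fr al atr]; split=> //.
- move=> n q x [U [Ux pq]].
  have [f fE] := affine_chart Ux.
  have [s sE] := al n (dMap_comp (plot_dMap pq) f).
  exists (s \o @affine_param n).
    exact: (plot_at_post (dMapP s) (affine_param_plot x)).
  apply: filterS fE => y fy.
  rewrite -[LHS]/(dMap_comp pr s (affine_param y)) sE /=.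
  by rewrite fy.
have /pointwise_division[dv dvE] :
    forall e e', pr e = pr e' -> exists g, e ** g = e'.
  move=> e e' ee'.
  have [|g gE] := @atr 0 (dMap_cst _ e) (dMap_cst _ e'); first exact: dMap_eq.
  by exists (g (affine_param 0)); apply: gE.
exists dv; split=> // n e e' x pe pe' ee'.
have : \forall y \near x, [/\ plot_at e y, plot_at e' y & pr (e y) = pr (e' y)].
  by near=> y; split; near: y => //; apply: plot_at_near.
move=> /near_edom[U Ux HU].
have pU : plot (fun u : U => e (val u)).
  by apply: plot_of_germs => u; exists e => //; case: (HU _ (set_valP u)).
have pU' : plot (fun u : U => e' (val u)).
  by apply: plot_of_germs => u; exists e' => //; case: (HU _ (set_valP u)).
have [f fE] := affine_chart Ux.
have [|g gE] := @atr n (dMap_comp (DMap (plot_smooth pU)) f)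
                       (dMap_comp (DMap (plot_smooth pU')) f).
  by apply: dMap_eq => a /=; case: (HU _ (set_valP (f a))).
apply: plot_at_eq (plot_at_post (dMapP g) (affine_param_plot x)).
apply: filterS2 fE (edom_nbhs Ux) => y fy Uy; apply: (fr (e y)).
rewrite dvE; last by case: (HU _ Uy).
by have := gE (affine_param y); rewrite /= fy.
Unshelve. all: end_near. Qed.

End AffineSimplices.

(** * Simplicial principal bundles *)

Section Simplicial.
Variables (R : realType) (G : diffGroup R) (X : diffSpace R) (P : dgOver G X).
Local Notation pr := (dgo_proj P).

Definition yoneda (K : sSet) p (x : K p) : sMap (std_simplex p) K :=
  @SMap (std_simplex p) K (fun n a => sop a x) (fun m n a b => sop_comp b a x).

(** Over the simplex classified by [c], the trivialization is read on the points
    of the pullback above the fundamental simplex of [Delta[p]]: these are the lifts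
    of [c], and they form a torsor under the [p]-simplices of the group.  Freeness
    on points follows from constant simplices. *)
Lemma affine_torsor_of_simplicial :
  simp_principal (saff_over P) -> affine_torsor P.
Proof.
move=> HP.
have triv p (c : saff X p) :
    (exists s : dMap (affine R p) P, dMap_comp pr s = c) /\
    (forall e e' : saff_space P p, dMap_comp pr e = c -> dMap_comp pr e' = c ->
       exists g : saff_group G p, sgs_act e g = e' /\
         forall h, sgs_act e h = e' -> h = g).
  have [f [f' [fK f'K fact fproj]]] := HP p (yoneda c).
  split.
    pose z := f' p (simp_id p, sg_one (saff_group G) p).
    exists (sval z).2.
    have := svalP z; rewrite -[RHS]/(dMap_comp pr (sval z).2) => <-.
    have := fproj p z; rewrite f'K /= => <-.
    exact: saff_id.
  move=> e e' ec ec'.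
  have cP (d : saff_space P p) : dMap_comp pr d = c ->
      yoneda c p (simp_id p) = saff_map pr p d.
    by move=> <-; exact: saff_id.
  pose mk d dc : sgo_pull (yoneda c) (saff_over P) p :=
    exist _ (simp_id p, d) (cP d dc).
  set z := mk e ec; set z' := mk e' ec'.
  have fstE d dc : (f p (mk d dc)).1 = simp_id p by have := fproj p (mk d dc).
  have actE h : sgs_act e h = e' -> sg_mul (f p z).2 h = (f p z').2.
    move=> eh; have -> : z' = sgs_act z h by apply: spull_eq; rewrite /= -eh.
    by rewrite fact.
  pose g := sg_mul (sg_inv (f p z).2) (f p z').2.
  exists g; split; last first.
    by move=> h /actE hE; rewrite /g -hE sg_mulA sg_mulVg sg_mul1g.
  suff /(congr1 (f' p)) : f p (sgs_act z g) = f p z'.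
    by rewrite !fK => /(congr1 (fun w => (sval w).2)).
  rewrite fact [RHS]surjective_pairing /= /striv_act !fstE /g.
  by rewrite sg_mulA sg_mulgV sg_mul1g.
split.
- move=> e g h egh.
  have [_ t] := triv 0%N (dMap_cst _ (pr e)).
  have [||k [_ kE]] := t (dMap_cst _ e) (dMap_cst _ (e ** g)).
  + exact: dMap_eq.
  + by apply: dMap_eq => a /=; rewrite dgo_projM.
  have hk : dMap_cst (affine R 0) h = k by apply: kE; apply: dMap_eq => a /=.
  have gk : dMap_cst (affine R 0) g = k by apply: kE; apply: dMap_eq.
  have := congr1 (fun m : dMap _ _ => m (affine_param 0)) (etrans gk (esym hk)).
  by [].
- by move=> n c; case: (triv n c).
move=> n e e' ee'; have [_ t] := triv n (dMap_comp pr e).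
have [//||g [<- _]] := t e e'; first exact: esym.
by exists g.
Qed.

(** A lift [s] of the simplex classified by [k] gives the points [S n a] above all
    simplices of [Delta[p]], compatibly with the simplicial operators; every other
    point of the pullback differs from them by a unique simplex of the group. *)
Lemma simplicial_of_affine_torsor :
  affine_torsor P -> simp_principal (saff_over P).
Proof.
move=> [fr al atr] p k.
have [s sE] := al p (k p (simp_id p)).
have kE n (a : simp_op n p) : k n a = sop a (dMap_comp pr s : saff X p).
  rewrite sE -sMap_sop; congr (k n _); exact: simp_op_eq.
pose S n (a : simp_op n p) : saff_space P n := sop a (s : saff P p).
have SE n (a : simp_op n p) : saff_map pr n (S n a) = k n a.
  by rewrite kE; apply: dMap_eq.
have sfr n (e : saff_space P n) g h : sgs_act e g = sgs_act e h -> g = h.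
  move=> egh; apply: dMap_eq => x; apply: (fr (e x)).
  exact: (congr1 (fun m : dMap _ _ => m x) egh).
pose D := sgo_pull k (saff_over P).
pose T := sgo_triv (saff_group G) (std_simplex p).
have ex n (z : D n) :
    exists g : saff_group G n, sgs_act (S n (sval z).1) g = (sval z).2.
  case: z => [[a e] /= ae].
  have [|g gE] := @atr n (S n a) e.
    by have := SE n a; rewrite ae.
  by exists g; apply: dMap_eq.
pose d n (z : D n) := sval (cid (ex n z)).
have dE n (z : D n) : sgs_act (S n (sval z).1) (d n z) = (sval z).2.
  exact: svalP (cid (ex n z)).
have SS m n (b : simp_op m n) (a : simp_op n p) :
    S m (simp_comp a b) = sop b (S n a).
  exact: sop_comp.
pose f n (z : D n) : T n := ((sval z).1, d n z).
have fS m n (b : simp_op m n) (z : D n) : f m (sop b z) = sop b (f n z).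
  congr pair; apply: (sfr _ (S m (sval (sop b z)).1)).
  rewrite dE [(sval (sop b z)).1]/(simp_comp (sval z).1 b) SS.
  by rewrite -(sgs_act_sop b (S n (sval z).1)) dE.
have gP n (z : T n) : k n z.1 = saff_map pr n (sgs_act (S n z.1) z.2).
  by rewrite (saff_projM (S n z.1)) SE.
pose g n (z : T n) : D n := exist _ (z.1, sgs_act (S n z.1) z.2) (gP n z).
have gS m n (b : simp_op m n) (z : T n) : g m (sop b z) = sop b (g n z).
  apply: spull_eq; congr pair.
  rewrite [(sop b z).1]/(simp_comp z.1 b) SS.
  exact/esym/sgs_act_sop.
exists (SMap fS), (SMap gS); split.
- move=> n z; apply: spull_eq.
  by rewrite [RHS]surjective_pairing; congr pair; exact: dE.
- move=> n [a h]; congr pair; apply: (sfr _ (S n a)).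
  exact: (dE n (g n (a, h))).
- move=> n z h; congr pair; apply: (sfr _ (S n (sval z).1)).
  by rewrite (dE n (sgs_act z h)) sgs_actM dE.
- by [].
Qed.

End Simplicial.

Lemma diff_principal_iff_simplicial (R : realType) (G : diffGroup R)
    (X : diffSpace R) (P : dgOver G X) :
  diff_principal P <-> simp_principal (saff_over P).
Proof.
split=> [/smooth_torsor_of_principal/affine_torsor_of_smooth|].
  exact: simplicial_of_affine_torsor.
move=> /affine_torsor_of_simplicial/smooth_torsor_of_affine.
exact: principal_of_smooth_torsor.
Qed.

(** The values of [f] are the values of [saff_map f] on constant [0]-simplices. *)
Lemma saff_map_inj (R : realType) (X Y : diffSpace R) :
  injective (@saff_map R X Y).
Proof.
move=> f g fg; apply: dMap_eq => x.
by have := congr1 (fun h : sMap (saff X) (saff Y) =>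
  (h 0%N (dMap_cst (affine R 0) x) : dMap _ _) (affine_param 0)) fg.
Qed.

Theorem theorem1p3 (R : realType) (G : diffGroup R) (X : diffSpace R) :
  (forall P : dgOver G X, diff_principal P <-> simp_principal (saff_over P)) /\
  (exists principal_saff : forall P : dgOver_cat G,
       is_diff_principal P -> is_simp_principal (saff_over_functor G P),
     @faithful (diff_principal_cat G) (simp_principal_cat (saff_group G))
       (restr_functor principal_saff)).
Proof.
split; first exact: diff_principal_iff_simplicial.
exists (fun P => (diff_principal_iff_simplicial (projT2 P)).1) => P Q s t st.
apply: dgSquare_eq; apply: saff_map_inj.
  exact: (congr1 (fun u => ssq_top u) st).
exact: (congr1 (fun u => ssq_base u) st).
Qed.
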